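(* Let $\mu$ be a symmetric classical measure, with second and fourth moments $a_2=\int t^2\,d\mu$ and $a_4=\int t^4\,d\mu$. Let $C\subset\mathbb{P}^3$ (over $\overline{\mathbb{Q}}$) be the curve defined by $$X_1^2+X_2^2+X_3^2-3a_2X_0^2=0,\qquad X_1^4+X_2^4+X_3^4-3a_4X_0^4=0,$$ whose rational affine points $(1:x_1:x_2:x_3)$ correspond to the $5$-designs $\{\pm x_1,\pm x_2,\pm x_3\}$ with $6$ rational points for $\mu$. If (the $5$-designs with $6$ rational points for $\mu$ are parametrized by rational functions in the sense that) every irreducible component of $C$ can be parametrized by rational functions, then $3a_2^2=2a_4$. Moreover, the only symmetric classical measure with $3a_2^2=2a_4$ is the Chebyshev measure $(1-t^2)^{-1/2}dt/\pi$ on $(-1,1)$.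
   Context: The symmetric classical measures are the Hermite measure $e^{-t^2}dt/\sqrt{\pi}$ on $(-\infty,\infty)$ and the Gegenbauer measures $(1-t^2)^{\lambda-1/2}dt/\int_{-1}^1(1-t^2)^{\lambda-1/2}dt$ on $(-1,1)$ with $\lambda>-1/2$ (the Chebyshev measure being $\lambda=0$). An $m$-design with $n$ points for a probability measure $w(t)dt$ on an interval $I$ is a set of $n$ pairwise distinct points $x_1,\dots,x_n\in I$ with $\frac1n\sum_i f(x_i)=\int_I f(t)w(t)dt$ for all real polynomials $f$ of degree at most $m$; it is rational if all $x_i\in\mathbb{Q}$. For symmetric classical measures every $5$-design with $6$ points is antipodal, i.e. of the form $\{\pm x_1,\pm x_2,\pm x_3\}$, and is then equivalent to $x_1^2+x_2^2+x_3^2=3a_2$, $x_1^4+x_2^4+x_3^4=3a_4$. *)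

(* Defs.v *)
From HB Require Import structures.
From mathcomp Require Import all_boot all_order all_algebra.
From mathcomp Require Import complex.
From mathcomp Require Import -(notations) mpoly.
From mathcomp Require Import all_classical all_reals all_analysis.

Set Implicit Arguments.
Unset Strict Implicit.
Unset Printing Implicit Defensive.

Import Order.TTheory GRing.Theory Num.Theory.
Import numFieldNormedType.Exports.

Local Open Scope classical_set_scope.
Local Open Scope ring_scope.

(* A measure w(t)dt on an interval is represented by the pair (I, w); only the
   values of w on I matter. *)

Definition hermite_weight (R : realType) (t : R) : R :=
  expR (- t ^+ 2) / Num.sqrt pi.

Definition gegenbauer_weight (R : realType) (lambda t : R) : R :=
  (1 - t ^+ 2) `^ (lambda - 2^-1) /
  \int[lebesgue_measure]_(s in `]-1, 1[%classic)
    ((1 - s ^+ 2) `^ (lambda - 2^-1)).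

Definition symmetric_classical_measure (R : realType) (I : set R) (w : R -> R) : Prop :=
  (I = setT /\ forall t, I t -> w t = hermite_weight t) \/
  exists lambda : R,
    [/\ - 2^-1 < lambda,
        I = `]-1, 1[%classic
      & forall t, I t -> w t = gegenbauer_weight lambda t].

Definition chebyshev_measure (R : realType) (I : set R) (w : R -> R) : Prop :=
  I = `]-1, 1[%classic /\
  forall t, I t -> w t = (1 - t ^+ 2) `^ (- 2^-1) / pi.

Definition wmoment (R : realType) (I : set R) (w : R -> R) (k : nat) : R :=
  \int[lebesgue_measure]_(t in I) (t ^+ k * w t).

Definition design (R : realType) (I : set R) (w : R -> R) (m n : nat)
    (x : n.-tuple R) : Prop :=
  [/\ uniq x,
      forall t, t \in x -> I t
    & forall f : {poly R}, (size f <= m.+1)%N ->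
        n%:R^-1 * \sum_(t <- x) f.[t] =
        \int[lebesgue_measure]_(t in I) (f.[t] * w t)].

Definition antipodal6 (x1 x2 x3 : rat) : 6.-tuple rat :=
  [tuple x1; - x1; x2; - x2; x3; - x3].

(* Subsets of P^n(K) are represented by the sets of the homogeneous coordinate
   vectors (nonzero, all of them) of their points. *)

Definition homogeneous (K : fieldType) (n : nat) (p : mpoly.mpoly n K) : Prop :=
  exists d : nat, p \is mpoly.ishomog1 d (@mpoly.mdeg n).

Definition proj_zeros (K : fieldType) (n : nat)
    (S : set (mpoly.mpoly n.+1 K)) : set 'rV[K]_n.+1 :=
  [set x | x != 0 /\ forall p, S p -> mpoly.meval (x ord0) p = 0].

Definition zariski_closed (K : fieldType) (n : nat) (A : set 'rV[K]_n.+1) : Prop :=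
  exists2 S : set (mpoly.mpoly n.+1 K),
    forall p, S p -> homogeneous p & A = proj_zeros S.

Definition irreducible_closed (K : fieldType) (n : nat)
    (A : set 'rV[K]_n.+1) : Prop :=
  [/\ zariski_closed A, A !=set0
    & forall B D : set 'rV[K]_n.+1, zariski_closed B -> zariski_closed D ->
        A `<=` B `|` D -> A `<=` B \/ A `<=` D].

Definition irreducible_component (K : fieldType) (n : nat)
    (Z A : set 'rV[K]_n.+1) : Prop :=
  [/\ irreducible_closed A, A `<=` Z
    & forall B : set 'rV[K]_n.+1, irreducible_closed B -> B `<=` Z ->
        A `<=` B -> B `<=` A].

(* The rational functions are num_i / den_i; ratmap_image is the set of values
   (num_0(t)/den_0(t) : ... : num_n(t)/den_n(t)), over the t in K at which every
   denominator is nonzero and the coordinates do not all vanish. *)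
Definition ratmap_image (K : fieldType) (n : nat)
    (num den : 'I_n.+1 -> {poly K}) : set 'rV[K]_n.+1 :=
  [set x | x != 0 /\ exists2 t : K, forall i, (den i).[t] != 0
                   & x = \row_i ((num i).[t] / (den i).[t])].

(* For a curve A: a nonconstant rational map P^1 --> A with Zariski dense
   image. *)
Definition rationally_parametrized (K : fieldType) (n : nat)
    (A : set 'rV[K]_n.+1) : Prop :=
  exists num den : 'I_n.+1 -> {poly K},
    [/\ forall i, den i != 0,
        exists x y : 'rV[K]_n.+1,
          [/\ ratmap_image num den x, ratmap_image num den y
            & forall c : K, y != c *: x],
        ratmap_image num den `<=` A
      & forall B : set 'rV[K]_n.+1, zariski_closed B ->
          ratmap_image num den `<=` B -> A `<=` B].

(* The literals 0, 1, 2, 3 below are those of the ring 'I_4 = Z/4Z. *)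
Definition coordX (K : fieldType) (i : 'I_4) : mpoly.mpoly 4 K :=
  mpoly.mpolyX K (mpoly.mnm1 i).

Definition design_curve (K : fieldType) (c2 c4 : K) : set 'rV[K]_4 :=
  proj_zeros
    [set coordX K 1 ^+ 2 + coordX K 2 ^+ 2 + coordX K 3 ^+ 2
           - (3 * c2) *: coordX K 0 ^+ 2;
         coordX K 1 ^+ 4 + coordX K 2 ^+ 4 + coordX K 3 ^+ 4
           - (3 * c4) *: coordX K 0 ^+ 4].

Definition affine_point (K : fieldType) (x1 x2 x3 : K) : 'rV[K]_4 :=
  \row_(i < 4) [:: 1; x1; x2; x3]`_i.

(* Main.v *)
(* Put X0 = 1. On the curve, (x2^2 - x3^2)^2 = -3 (x1^2 - r)(x1^2 - s) with
   r + s = 2 a2 and r s = 3 a2^2 - 2 a4.  If r s != 0 and r != s, write a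
   rational parametrization as x1 = u / v with coprime polynomials u, v and
   r = rho^2, s = sigma^2: the linear forms u +- rho v, u +- sigma v are pairwise
   coprime and their product is a square up to a constant, so each of them is a
   square, and infinite descent on the degree forces u and v to be constant.  By
   symmetry all the coordinates are constant; at infinity (X0 = 0) the curve has
   finitely many points.  Hence no component is parametrized unless
   3 a2^2 = 2 a4 (r != s because a4 > a2^2).
   The moments come from integrating the derivatives of t^k exp(-t^2) and of
   t^k (1 - t^2)^(lambda + 1/2): a2 = 1/2, a4 = 3/4 for the Hermite measure, and
   a2 = 1/(2 lambda + 2), a4 = 3/((2 lambda + 2)(2 lambda + 4)) for the
   Gegenbauer measures, where 3 a2^2 = 2 a4 exactly when lambda = 0. *)

Require Import Defs.
From HB Require Import structures.
From mathcomp Require Import all_boot all_order all_algebra.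
From mathcomp Require Import complex ring lra.
From mathcomp Require Import -(notations) mpoly.
From mathcomp Require Import all_classical all_reals all_analysis measurable_realfun.

Set Implicit Arguments.
Unset Strict Implicit.
Unset Printing Implicit Defensive.

Import Order.TTheory GRing.Theory Num.Theory.
Import numFieldNormedType.Exports.

Local Open Scope classical_set_scope.
Local Open Scope ring_scope.

(** * Infinite descent over polynomials *)

Lemma closed_sqrt (K : closedFieldType) (c : K) : exists d : K, d ^+ 2 = c.
Proof.
have /closed_rootP[d] : size ('X^2 - c%:P : {poly K}) != 1 by rewrite size_XnsubC.
by rewrite rootE !hornerE subr_eq0 => /eqP; exists d.
Qed.

(** Induction on the size of [r]. A root [a] of [r] is a root of exactly one of the coprime factors,
    so [('X - a%:P) ^+ 2] divides that factor and can be cancelled against [r ^+ 2]. Constants are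
    squares because [K] is algebraically closed. *)
Lemma coprimep_mul_square (K : closedFieldType) (p q r : {poly K}) :
  coprimep p q -> p * q = r ^+ 2 -> exists s, p = s ^+ 2.
Proof.
have [n] := ubnP (size r); elim: n p q r => // n IHn p q r szr cpq pq.
have const_square (f : {poly K}) : (size f <= 1)%N -> exists s, f = s ^+ 2.
  move=> /size1_polyC ->; have [d <-] := closed_sqrt f`_0.
  by exists d%:P; rewrite -polyC_exp.
have [r0|r0] := eqVneq r 0.
  move: pq; rewrite r0 expr0n /= => /eqP; rewrite mulf_eq0 => /orP[]/eqP z.
    by exists 0; rewrite expr0n.
  by move: cpq; rewrite z coprimep0 -size_poly_eq1 => /eqP sp; apply: const_square; rewrite sp.
have pq0 : p * q != 0 by rewrite pq expf_neq0.
move: (pq0); rewrite mulf_eq0 negb_or => /andP[p0 q0].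
have [sr|] := boolP (size r != 1); last first.
  rewrite negbK => /eqP sr; apply: const_square.
  have : size (p * q) = 1 by rewrite pq expr2 size_mul // sr.
  rewrite size_mul //; move: p0 q0; rewrite -!size_poly_gt0.
  by case: (size p) => [|[|a]] // _; case: (size q) => [|b] // _; rewrite addSn addnS.
have /closed_rootP[a ra] := sr.
move: (ra) => /factor_theorem[r' rE].
have X0 : 'X - a%:P != 0 :> {poly K} by rewrite polyXsubC_eq0.
have r'0 : r' != 0 by apply: contraNneq r0 => z; rewrite rE z mul0r.
have szr' : (size r' < n)%N by move: szr; rewrite rE size_Mmonic ?monicXsubC // size_XsubC addn2.
have key f g : coprimep f g -> f * g = r ^+ 2 -> root f a ->
    exists2 f', f = f' * ('X - a%:P) ^+ 2 & f' * g = r' ^+ 2.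
  move=> cfg fg fa.
  have /dvdpP[f' fE] : (('X - a%:P) ^+ 2 %| f).
    rewrite -(@Gauss_dvdpl _ f g); first by rewrite fg rE exprMn dvdp_mull.
    rewrite coprimep_pexpl // coprimep_sym coprimep_XsubC.
    exact: (coprimep_root cfg).
  exists f' => //; apply: (mulIf (expf_neq0 2 X0)).
  by rewrite -exprMn -rE -fg fE; ring.
have : root (p * q) a by rewrite pq rootE hornerE (rootP ra) expr0n.
rewrite rootM => /orP[pa|qa].
  have [p' pE p'q] := key _ _ cpq pq pa.
  have cp'q : coprimep p' q by move: cpq; rewrite pE coprimepMl => /andP[].
  have [s sE] := IHn _ _ _ szr' cp'q p'q.
  by exists (s * ('X - a%:P)); rewrite pE sE exprMn.
have cqp : coprimep q p by rewrite coprimep_sym.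
have [|q' qE q'p] := key _ _ cqp _ qa; first by rewrite mulrC.
apply: (IHn p q' r') => //; last by rewrite mulrC.
by move: cpq; rewrite qE coprimepMr => /andP[].
Qed.

(* The constant [c] is harmless: it is itself a square. *)
Lemma coprimep_mul_scale_square (K : closedFieldType) (p q r : {poly K}) (c : K) :
  coprimep p q -> p * q = c *: r ^+ 2 -> exists s, p = s ^+ 2.
Proof.
have [d <-] := closed_sqrt c => cpq pq.
by apply: (coprimep_mul_square (r := d *: r) cpq); rewrite pq exprZn.
Qed.

(** By Cramer's rule, a common root of the two combinations is a common root of [u] and [v]. *)
Lemma coprimep_lin_comb (K : closedFieldType) (u v : {poly K}) (a b c d : K) :
  a * d != b * c -> coprimep u v ->
  coprimep (a *: u + b *: v) (c *: u + d *: v).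
Proof.
move=> det cuv; apply: Pdiv.ClosedField.root_coprimep => x /rootP; rewrite !hornerE => e1.
apply/eqP => e2; have {}det : a * d - b * c != 0 by rewrite subr_eq0.
have u0 : u.[x] = 0.
  apply: (mulfI det); rewrite mulr0.
  transitivity (d * (a * u.[x] + b * v.[x]) - b * (c * u.[x] + d * v.[x])); first by ring.
  by rewrite e1 e2; ring.
have v0 : v.[x] = 0.
  apply: (mulfI det); rewrite mulr0.
  transitivity (a * (c * u.[x] + d * v.[x]) - c * (a * u.[x] + b * v.[x])); first by ring.
  by rewrite e1 e2; ring.
by have /negP := coprimep_root cuv (introT rootP u0); rewrite v0.
Qed.

(** The halving of degrees that drives the descent; the bounds also cover [p = 0]. *)
Lemma size_sqr_poly_le (K : idomainType) (p : {poly K}) (m : nat) :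
  (size (p ^+ 2) <= m.+1)%N -> (size p <= (m./2).+1)%N.
Proof.
move=> h; have := size_exp p 2.
have {h} : ((size (p ^+ 2)).-1 <= m)%N by rewrite -ltnS; case: (size (p ^+ 2)) h.
move=> h e; move: h; rewrite e muln2 => /half_leq; rewrite doubleK.
by case: (size p).
Qed.

(* Infinite descent: with u + rho v = A^2 and u - rho v = B^2, the forms
   u + sigma v and u - sigma v factor over linear forms in A and B, so (A, B)
   satisfies the hypotheses for (beta / alpha, alpha / beta), where
   alpha^2 = sigma + rho and beta^2 = sigma - rho. *)
Lemma four_squares_const (K : closedFieldType) (rho sigma : K) (u v : {poly K}) :
  (2 : K) != 0 -> rho != 0 -> sigma != 0 -> rho ^+ 2 != sigma ^+ 2 ->
  coprimep u v ->
  (exists s, u + rho *: v = s ^+ 2) -> (exists s, u - rho *: v = s ^+ 2) ->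
  (exists s, u + sigma *: v = s ^+ 2) -> (exists s, u - sigma *: v = s ^+ 2) ->
  (size u <= 1)%N /\ (size v <= 1)%N.
Proof.
move=> two0.
have [n] := ubnP (maxn (size u) (size v)).
elim: n rho sigma u v => // n IHn rho sigma u v szn rho0 sigma0 rs cuv.
move=> [A AE] [B BE] [C CE] [D DE].
have [alpha alphaE] := closed_sqrt (sigma + rho).
have [beta betaE] := closed_sqrt (sigma - rho).
have alpha0 : alpha != 0.
  apply: contraNneq rs => z; move: alphaE; rewrite z expr0n /= => /eqP.
  by rewrite eq_sym addr_eq0 => /eqP ->; rewrite sqrrN.
have beta0 : beta != 0.
  apply: contraNneq rs => z; move: betaE; rewrite z expr0n /= => /eqP.
  by rewrite eq_sym subr_eq0 => /eqP ->.
have cAB : coprimep A B.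
  have := @coprimep_lin_comb _ u v 1 rho 1 (- rho).
  rewrite !scale1r scaleNr AE BE coprimep_pexpl // coprimep_pexpr // => -> //.
  by rewrite mulr1 mul1r eq_sym -addr_eq0 -mulr2n -mulr_natl mulf_neq0.
have r20 : 2 * rho != 0 by rewrite mulf_neq0.
(* Since [alpha ^+ 2 - beta ^+ 2 = 2 * rho] and [alpha ^+ 2 + beta ^+ 2 = 2 * sigma] are nonzero,
   the fourth powers of [alpha] and [beta] differ. This is the distinctness hypothesis for the pair
   [(beta / alpha, alpha / beta)]. *)
have ab4 : beta * beta != alpha * alpha.
  apply: contra_neq rho0 => e; apply: (mulfI two0); rewrite mulr0.
  have : alpha ^+ 2 - beta ^+ 2 = 0 by rewrite !expr2 e subrr.
  by rewrite alphaE betaE => <-; ring.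
have ab4' : beta * beta != - (alpha * alpha).
  apply: contra_neq sigma0 => e; apply: (mulfI two0); rewrite mulr0.
  have : alpha ^+ 2 + beta ^+ 2 = 0 by rewrite !expr2 e subrr.
  by rewrite alphaE betaE => <-; ring.
have abE : alpha * beta != 0 by rewrite mulf_neq0.
have Cf : (alpha *: A + beta *: B) * (alpha *: A - beta *: B) = (2 * rho) *: C ^+ 2.
  rewrite -CE -!mul_polyC.
  transitivity ((alpha ^+ 2)%:P * A ^+ 2 - (beta ^+ 2)%:P * B ^+ 2).
    by rewrite !polyC_exp; ring.
  by rewrite alphaE betaE -AE -BE -!mul_polyC !(polyCD, polyCN, polyCM); ring.
have Df : (beta *: A + alpha *: B) * (beta *: A - alpha *: B) = (- (2 * rho)) *: D ^+ 2.
  rewrite -DE -!mul_polyC.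
  transitivity ((beta ^+ 2)%:P * A ^+ 2 - (alpha ^+ 2)%:P * B ^+ 2).
    by rewrite !polyC_exp; ring.
  by rewrite alphaE betaE -AE -BE -!mul_polyC !(polyCD, polyCN, polyCM); ring.
have sq (a b c : K) (E : {poly K}) : a != 0 -> b != 0 ->
    (a *: A + b *: B) * (a *: A - b *: B) = c *: E ^+ 2 ->
    (exists s, A + (b / a) *: B = s ^+ 2) /\ (exists s, A - (b / a) *: B = s ^+ 2).
  move=> a0 b0 eE.
  have cop : coprimep (a *: A + b *: B) (a *: A - b *: B).
    rewrite -scaleNr; apply: coprimep_lin_comb => //.
    by rewrite mulrN eq_sym -addr_eq0 [b * a]mulrC -mulr2n -mulr_natl !mulf_neq0.
  (* Making the coefficient of [A] equal to 1 preserves squares, as [a^-1] has a square root. *)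
  have scl (x : K) (s : {poly K}) : a *: A + x *: B = s ^+ 2 ->
      exists s, A + (x / a) *: B = s ^+ 2.
    move=> es; have [d dE] := closed_sqrt a^-1; exists (d *: s).
    by rewrite exprZn dE -es scalerDr !scalerA mulVf // scale1r [_ / _]mulrC.
  have [s /scl h1] := coprimep_mul_scale_square cop eE; split=> //.
  rewrite coprimep_sym in cop; rewrite mulrC in eE.
  have [t tE] := coprimep_mul_scale_square cop eE.
  by rewrite -scaleNr -mulNr; apply: (scl _ t); rewrite scaleNr.
have [C1 C2] := sq _ _ _ _ alpha0 beta0 Cf.
have [D1 D2] := sq _ _ _ _ beta0 alpha0 Df.
(* [m] bounds the degrees of [u] and [v], so [A] and [B] have degree at most [m./2]. This is a
   strict drop unless [m = 0], where the claim already holds. *)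
set m := (maxn (size u) (size v)).-1.
have szuv : (size u <= m.+1)%N /\ (size v <= m.+1)%N.
  by rewrite /m; split; apply: leq_trans (leqSpred _); rewrite ?leq_maxl ?leq_maxr.
have szA : (size A <= m./2.+1)%N.
  apply: size_sqr_poly_le; rewrite -AE (leq_trans (size_polyD _ _)) // geq_max.
  by rewrite szuv.1 (leq_trans (size_scale_leq _ _)) // szuv.2.
have szB : (size B <= m./2.+1)%N.
  apply: size_sqr_poly_le; rewrite -BE -scaleNr (leq_trans (size_polyD _ _)) // geq_max.
  by rewrite szuv.1 (leq_trans (size_scale_leq _ _)) // szuv.2.
have [m0|m0] := posnP m; first by move: szuv; rewrite m0.
have mn : (m < n)%N by move: szn m0; rewrite /m; case: (maxn _ _).
have hm : (m./2 < m)%N by rewrite -divn2 ltn_Pdiv.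
have [||||//|//|//|//|//|A1 B1] := IHn (beta / alpha) (alpha / beta) A B.
- by rewrite gtn_max (leq_ltn_trans _ mn) ?(leq_trans szA) ?(leq_ltn_trans _ mn) ?(leq_trans szB).
- by rewrite mulf_neq0 ?invr_neq0.
- by rewrite mulf_neq0 ?invr_neq0.
- rewrite !expr_div_n eqr_div ?expf_neq0 // -!exprMn -!expr2 -subr_eq0.
  rewrite (_ : _ - _ = (beta * beta - alpha * alpha) * (beta * beta + alpha * alpha)); last by ring.
  by rewrite mulf_neq0 // ?subr_eq0 // addr_eq0.
have szA2 : (size (A ^+ 2) <= 1)%N by rewrite (leq_trans (size_poly_exp_leq _ _)) // ltnS; case: (size A) A1 => [|[]].
have szB2 : (size (B ^+ 2) <= 1)%N by rewrite (leq_trans (size_poly_exp_leq _ _)) // ltnS; case: (size B) B1 => [|[]].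
(* The constancy of [A] and [B] passes back to [u] and [v], which are linear combinations of their
   squares. *)
have -> : u = 2^-1 *: (A ^+ 2 + B ^+ 2).
  by rewrite -AE -BE addrACA subrr addr0 -mulr2n -scaler_nat scalerA mulVf // scale1r.
have -> : v = (2 * rho)^-1 *: (A ^+ 2 - B ^+ 2).
  rewrite -AE -BE (_ : _ - _ = (2 * rho) *: v) ?scalerA ?mulVf ?scale1r //.
  by rewrite -!mul_polyC polyCM -[2%:P]/(2%:R%:P) polyC_natr; ring.
split; rewrite (leq_trans (size_scale_leq _ _)) // (leq_trans (size_polyD _ _)) //;
  by rewrite geq_max szA2 ?size_polyN szB2.
Qed.

Lemma curve_coord_const (K : closedFieldType) (c2 c4 : K) (P0 P1 P2 P3 : {poly K}) :
  (2 : K) != 0 -> (3 : K) != 0 -> c4 != c2 ^+ 2 -> 3 * c2 ^+ 2 != 2 * c4 ->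
  P0 != 0 ->
  P1 ^+ 2 + P2 ^+ 2 + P3 ^+ 2 = (3 * c2) *: P0 ^+ 2 ->
  P1 ^+ 4 + P2 ^+ 4 + P3 ^+ 4 = (3 * c4) *: P0 ^+ 4 ->
  exists c, P1 = c *: P0.
Proof.
move=> two0 three0 c42 c24 P00 e1 e2.
(* [c2 + delta] and [c2 - delta] are the roots of T^2 - 2 c2 T + (3 c2^2 - 2 c4). They are distinct
   because [c4 != c2 ^+ 2], and nonzero because their product is 3 c2^2 - 2 c4. *)
have [delta deltaE] := closed_sqrt (2 * (c4 - c2 ^+ 2)).
have delta0 : delta != 0.
  rewrite -sqrf_eq0 deltaE mulf_neq0 // subr_eq0 //.
have [rho rhoE] := closed_sqrt (c2 + delta).
have [sigma sigmaE] := closed_sqrt (c2 - delta).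
have rsE : rho ^+ 2 * sigma ^+ 2 = 3 * c2 ^+ 2 - 2 * c4.
  by rewrite rhoE sigmaE mulrC -subr_sqr deltaE; ring.
have rsD : rho ^+ 2 + sigma ^+ 2 = 2 * c2 by rewrite rhoE sigmaE; ring.
have : rho ^+ 2 * sigma ^+ 2 != 0 by rewrite rsE subr_eq0.
rewrite mulf_eq0 negb_or !sqrf_eq0 => /andP[rho0 sigma0].
have rs : rho ^+ 2 != sigma ^+ 2.
  rewrite rhoE sigmaE -subr_eq0 (_ : _ - _ = 2 * delta) ?mulf_neq0 //; ring.
(* From (x - y)^2 = 2 (x^2 + y^2) - (x + y)^2 with x = P2^2 and y = P3^2, both sums being expressed
   through [P0] and [P1] by the equations of the curve. *)
have h2E : (P2 ^+ 2 - P3 ^+ 2) ^+ 2 =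
    (- 3) *: ((P1 ^+ 2 - (rho ^+ 2) *: P0 ^+ 2) * (P1 ^+ 2 - (sigma ^+ 2) *: P0 ^+ 2)).
  transitivity (2%:R * ((3 * c4) *: P0 ^+ 4 - P1 ^+ 4) - ((3 * c2) *: P0 ^+ 2 - P1 ^+ 2) ^+ 2).
    by rewrite -e1 -e2; ring.
  transitivity ((- 3) *: (P1 ^+ 4 - (rho ^+ 2 + sigma ^+ 2) *: (P0 ^+ 2 * P1 ^+ 2)
      + (rho ^+ 2 * sigma ^+ 2) *: P0 ^+ 4)); last first.
    by congr (_ *: _); rewrite -!mul_polyC !(polyCD, polyCM); ring.
  have p2 : (2 : K)%:P = 2%:R by exact: polyC_natr.
  have p3 : (3 : K)%:P = 3%:R by exact: polyC_natr.
  rewrite rsE rsD -!mul_polyC !(p2, p3, polyCM, polyCN, polyC_exp, polyCD).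
  by ring.
set g := gcdp P1 P0.
have g0 : g != 0 by rewrite gcdp_eq0 negb_and P00 orbT.
have P1E : P1 = (P1 %/ g) * g by rewrite divpK // dvdp_gcdl.
have P0E : P0 = (P0 %/ g) * g by rewrite divpK // dvdp_gcdr.
have cuv : coprimep (P1 %/ g) (P0 %/ g) by rewrite coprimep_div_gcd // P00 orbT.
move: (P1 %/ g) (P0 %/ g) P1E P0E cuv => u v P1E P0E cuv.
pose f a := u + a *: v.
have fE : (P2 ^+ 2 - P3 ^+ 2) ^+ 2 =
    (- 3) *: (f rho * (f (- rho) * f sigma * f (- sigma))) * (g ^+ 2) ^+ 2.
  rewrite h2E P1E P0E -!scalerAl; congr (_ *: _); rewrite /f -!mul_polyC !polyCN !polyC_exp.
  by ring.
(* The gcd enters the right-hand side of [fE] as the square of [g ^+ 2], so it can be cancelled,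
   leaving four pairwise coprime linear forms in [u] and [v]. *)
have /dvdpP[h hE] : g ^+ 2 %| P2 ^+ 2 - P3 ^+ 2.
  by rewrite -(@dvdp_pexp2r _ _ _ 2) // fE dvdp_mull.
have {}fE : f rho * (f (- rho) * f sigma * f (- sigma)) = (- 3)^-1 *: h ^+ 2.
  have : h ^+ 2 = (- 3) *: (f rho * (f (- rho) * f sigma * f (- sigma))).
    by apply: (mulIf (expf_neq0 2 (expf_neq0 2 g0))); rewrite -fE hE; ring.
  by move=> ->; rewrite scalerA mulVf ?scale1r // oppr_eq0.
have cf a b : a != b -> coprimep (f a) (f b).
  move=> ab; rewrite /f -[u]scale1r; apply: coprimep_lin_comb => //.
  by rewrite mul1r mulr1 eq_sym.
have sq a b c d : a != b -> a != c -> a != d ->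
    f a * (f b * f c * f d) = (- 3)^-1 *: h ^+ 2 -> exists s, f a = s ^+ 2.
  move=> ab ac ad; apply: coprimep_mul_scale_square.
  by rewrite !coprimepMr !cf.
have neN (a : K) : a != 0 -> a != - a.
  by move=> a0; rewrite -addr_eq0 -mulr2n -mulr_natl mulf_neq0.
have rs1 : rho != sigma by apply: contraNneq rs => ->.
have rs2 : rho != - sigma by apply: contraNneq rs => ->; rewrite sqrrN.
have rs3 : - rho != sigma by rewrite eqr_oppLR.
have rs4 : - rho != - sigma by rewrite eqr_opp.
have [u1 v1] : (size u <= 1)%N /\ (size v <= 1)%N.
  apply: (four_squares_const two0 rho0 sigma0 rs cuv).
  - by apply: (sq _ (- rho) sigma (- sigma)); rewrite ?neN.
  - rewrite -scaleNr; apply: (sq _ rho sigma (- sigma)) => //; first by rewrite eq_sym neN.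
    by rewrite -fE; ring.
  - apply: (sq _ rho (- rho) (- sigma)); rewrite ?neN //; try by rewrite eq_sym.
    by rewrite -fE; ring.
  - rewrite -scaleNr; apply: (sq _ rho (- rho) sigma); try by rewrite eq_sym ?neN.
    by rewrite -fE; ring.
have v0 : v`_0 != 0.
  apply: contraNneq P00 => z; rewrite P0E (size1_polyC v1) z mul0r //.
exists (u`_0 / v`_0).
rewrite P1E P0E (size1_polyC u1) (size1_polyC v1) !coefC /= !mul_polyC scalerA.
by rewrite divfK.
Qed.

(** * Points of the curve at infinity *)

Lemma primitive_cube_root (K : closedFieldType) :
  exists w : K, w ^+ 2 + w + 1 = 0.
Proof.
have /closed_rootP[w] : size ('X^2 + ('X + 1%:P) : {poly K}) != 1.
  by rewrite size_polyDl ?size_polyXn // size_XaddC.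
by rewrite rootE !hornerE => /eqP; exists w.
Qed.

(** Eliminating [P3] gives P1^4 + P1^2 P2^2 + P2^4 = 0 after division by 2. With [w] a root of T^2 +
    T + 1, the left side is (P1^2 - w P2^2)(P1^2 - w^2 P2^2), which splits into linear forms over
    [K]. *)
Lemma fermat_intersection_const (K : closedFieldType) (P1 P2 P3 : {poly K}) :
  (2 : K) != 0 ->
  P1 ^+ 2 + P2 ^+ 2 + P3 ^+ 2 = 0 -> P1 ^+ 4 + P2 ^+ 4 + P3 ^+ 4 = 0 ->
  exists c, P1 = c *: P2.
Proof.
move=> two0 e1 e2; have [w wE] := primitive_cube_root K.
have sqE : (P1 ^+ 2 - w *: P2 ^+ 2) * (P1 ^+ 2 - (w ^+ 2) *: P2 ^+ 2) = 0.
  have w2 : w ^+ 2 = - w - 1.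
    by apply/eqP; rewrite -subr_eq0 -wE; apply/eqP; ring.
  have w3 : w ^+ 3 = 1.
    by rewrite exprS w2 mulrBr mulr1 mulrN -expr2 w2; ring.
  transitivity (P1 ^+ 4 - (w + w ^+ 2) *: (P1 ^+ 2 * P2 ^+ 2) + (w ^+ 3) *: P2 ^+ 4).
    by rewrite -!mul_polyC !(polyCD, polyC_exp); ring.
  rewrite w3 w2 (_ : w + (- w - 1) = -1); last by ring.
  rewrite scaleN1r opprK scale1r.
  have two0' : (2 : {poly K}) != 0 by rewrite -[2]/(2%:R) -polyC_natr polyC_eq0.
  apply: (mulfI two0'); rewrite mulr0.
  transitivity ((P1 ^+ 2 + P2 ^+ 2) ^+ 2 - P3 ^+ 4 + (P1 ^+ 4 + P2 ^+ 4 + P3 ^+ 4)).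
    by ring.
  have -> : P1 ^+ 2 + P2 ^+ 2 = - P3 ^+ 2 by apply/eqP; rewrite -addr_eq0 e1.
  by rewrite e2; ring.
have lin a : P1 ^+ 2 - a *: P2 ^+ 2 = 0 -> exists c, P1 = c *: P2.
  have [d <-] := closed_sqrt a; rewrite -exprZn subr_sqr => /eqP.
  rewrite mulf_eq0 subr_eq0 addr_eq0 => /orP[]/eqP ->; first by exists d.
  by exists (- d); rewrite scaleNr.
by move/eqP: sqE; rewrite mulf_eq0 => /orP[]/eqP/lin.
Qed.

(** * Irreducible components and parametrizations of the design curve *)

(* In [proj_zeros], [x != 0] is elaborated at the type of functions. *)
Lemma fun_of_matrix_neq0 (K : fieldType) (m n : nat) (x : 'M[K]_(m, n)) :
  (fun_of_matrix x != 0) = (x != 0).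
Proof.
congr negb; apply/eqP/eqP => [h|->].
  by apply/matrixP => i j; rewrite mxE; move: h => /(congr1 (fun f => f i j)).
by apply/funext => i; apply/funext => j; rewrite mxE.
Qed.

Lemma proj_zerosP (K : fieldType) (n : nat) (S : set (mpoly.mpoly n.+1 K))
    (x : 'rV[K]_n.+1) :
  proj_zeros S x <->
  (x != 0 /\ forall p, S p -> mpoly.meval (x ord0) p = 0).
Proof. by rewrite /proj_zeros /= fun_of_matrix_neq0. Qed.

Definition zariski_closure (K : fieldType) (n : nat) (A : set 'rV[K]_n.+1) :
    set 'rV[K]_n.+1 :=
  proj_zeros [set p | homogeneous p /\
                      forall x, A x -> mpoly.meval (x ord0) p = 0].

Lemma zariski_closure_closed (K : fieldType) (n : nat) (A : set 'rV[K]_n.+1) :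
  zariski_closed (zariski_closure A).
Proof. by eexists; last reflexivity; move=> p []. Qed.

Lemma sub_zariski_closure (K : fieldType) (n : nat) (A : set 'rV[K]_n.+1) :
  (forall x, A x -> x != 0) -> A `<=` zariski_closure A.
Proof. by move=> A0 x Ax; apply/proj_zerosP; split; [exact: A0|move=> p [_]; exact]. Qed.

Lemma zariski_closure_min (K : fieldType) (n : nat) (A B : set 'rV[K]_n.+1) :
  zariski_closed B -> A `<=` B -> zariski_closure A `<=` B.
Proof.
move=> [S Sh ->] AB x [x0 xA]; split=> // p Sp; apply: xA; split; first exact: Sh.
by move=> y /AB[_]; exact.
Qed.

(* Zorn is applied to subsets that need not be closed: a maximal irreducible
   subset of Z equals its closure. *)
Lemma exists_irreducible_component (K : fieldType) (n : nat)
    (Z : set 'rV[K]_n.+1) :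
  zariski_closed Z -> Z !=set0 -> exists A, irreducible_component Z A.
Proof.
move=> Zc [x Zx].
pose irr (A : set 'rV[K]_n.+1) := forall B D : set 'rV[K]_n.+1,
  zariski_closed B -> zariski_closed D ->
  A `<=` B `|` D -> A `<=` B \/ A `<=` D.
have Z0 y : Z y -> y != 0 by case: Zc => S _ -> /proj_zerosP[].
have irr_closure A : irr A -> A `<=` Z -> irr (zariski_closure A).
  move=> Ai AZ B D Bc Dc ABD; have Acl : A `<=` zariski_closure A.
    by apply: sub_zariski_closure => y /AZ/Z0.
  by have [] := Ai _ _ Bc Dc (subset_trans Acl ABD) => h; [left|right];
    exact: zariski_closure_min.
have [|A [[AZ Ai] Amax]] := @Zorn_bigcup _ [set A | A `<=` Z /\ irr A].
  move=> F FP Ftot; split; first by apply: bigcup_sub => A /FP[].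
  move=> B D Bc Dc UBD.
  have FBD A : F A -> A `<=` B \/ A `<=` D.
    move=> FA; have [_ Ai] := FP _ FA; apply: Ai => //.
    by apply: subset_trans UBD; exact: bigcup_sup.
  (* If some member [A0] of the chain is not inside [B], it lies in [D]. Smaller members then lie in
     [D] with it, and larger ones cannot lie in [B], so they lie in [D] too. *)
  have [h|/existsNP[A0 /not_implyP[FA0 A0B]]] := pselect (forall A, F A -> A `<=` B).
    by left; exact: bigcup_sub.
  right; apply: bigcup_sub => A FA.
  have A0D : A0 `<=` D by case: (FBD _ FA0).
  have [h|h] := Ftot _ _ FA FA0; first exact: subset_trans h A0D.
  by case: (FBD _ FA) => // AB; case: A0B; exact: subset_trans AB.
have Acl : A `<=` zariski_closure A by apply: sub_zariski_closure => y /AZ/Z0.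
have maxE B : A `<=` B -> B `<=` Z -> irr B -> B `<=` A.
  by move=> AB BZ Bi; apply: contrapT => nBA; exact: (Amax B).
have clA : zariski_closure A = A.
  apply/seteqP; split=> //; apply: maxE => //; first exact: zariski_closure_min.
  exact: irr_closure.
exists A; split=> //; last by move=> B [_ _ Bi] BZ AB; exact: maxE.
split=> //; first by rewrite -clA; exact: zariski_closure_closed.
(* The empty set satisfies [irr] vacuously, so nonemptiness needs an argument: the irreducible set
   [[set x]] would properly contain an empty maximal set. *)
apply/set0P/negP => /eqP A0.
have xi : irr [set x] by move=> B D _ _ /(_ x erefl)[] h; [left|right] => _ ->.
have xZ : [set x] `<=` Z by move=> _ ->.
suff : [set x] `<=` A by move=> /(_ x erefl); rewrite A0.
by apply: maxE => //; rewrite A0.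
Qed.

Lemma design_curveP (K : fieldType) (c2 c4 : K) (x : 'rV[K]_4) :
  design_curve c2 c4 x <->
  [/\ x != 0,
      x ord0 1 ^+ 2 + x ord0 2 ^+ 2 + x ord0 3 ^+ 2 = 3 * c2 * x ord0 0 ^+ 2
    & x ord0 1 ^+ 4 + x ord0 2 ^+ 4 + x ord0 3 ^+ 4 = 3 * c4 * x ord0 0 ^+ 4].
Proof.
have ev (k : nat) (c : K) : mpoly.meval (x ord0) (coordX K 1 ^+ k + coordX K 2 ^+ k + coordX K 3 ^+ k
           - c *: coordX K 0 ^+ k) =
    x ord0 1 ^+ k + x ord0 2 ^+ k + x ord0 3 ^+ k - c * x ord0 0 ^+ k.
  by rewrite mpoly.mevalB !mpoly.mevalD mpoly.mevalZ !rmorphXn /= !mpoly.mevalXU.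
split=> [/proj_zerosP[x0 h]|[x0 e2 e4]].
  split=> //; apply/eqP; rewrite -subr_eq0; apply/eqP; rewrite -ev; apply: h.
    by left.
  by right.
by apply/proj_zerosP; split=> // p [->|->]; rewrite ev ?e2 ?e4 subrr.
Qed.

Lemma design_curve_closed (K : fieldType) (c2 c4 : K) :
  zariski_closed (design_curve c2 c4).
Proof.
eexists; last reflexivity.
have hX i k : coordX K i ^+ k \is mpoly.ishomog1 k (@mpoly.mdeg 4).
  have := @mpoly.dhomogMn 4 K _ 1 (coordX K i) k; rewrite mul1n; apply.
  by rewrite mpoly.dhomogX /= mpoly.mdeg1.
move=> p [->|->]; [exists 2%N|exists 4%N]; rewrite -scaleNr;
  by rewrite !rpredD ?rpredZ.
Qed.

Lemma design_curve_nonempty (K : closedFieldType) (c2 c4 : K) :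
  design_curve c2 c4 !=set0.
Proof.
have [w wE] := primitive_cube_root K.
have w3 : w ^+ 3 = 1.
  transitivity ((w ^+ 2 + w + 1) * (w - 1) + 1); first by ring.
  by rewrite wE; ring.
(* A point at infinity, which lies on the curve for all [c2] and [c4]: its squares are 1, w, w^2 and
   its fourth powers 1, w^2, w. *)
pose x : 'rV[K]_4 := \row_(i < 4) [:: 0; 1; w ^+ 2; w]`_i.
exists x; apply/design_curveP; rewrite !mxE /=.
split.
- apply/eqP => /matrixP /(_ ord0 1); rewrite !mxE /= => /eqP.
  by rewrite oner_eq0.
- transitivity (1 + w ^+ 3 * w + w ^+ 2); first by ring.
  rewrite w3; transitivity (w ^+ 2 + w + 1); first by ring.
  by rewrite wE; ring.
- transitivity (1 + w ^+ 3 * w ^+ 3 * w ^+ 2 + w ^+ 3 * w); first by ring.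
  rewrite w3; transitivity (w ^+ 2 + w + 1); first by ring.
  by rewrite wE; ring.
Qed.

(** After clearing denominators, the coordinates are polynomials satisfying the equations of the
    curve identically. They are then all constant multiples of one of them, so the image is a single
    projective point, whereas a parametrization takes two distinct values. *)
Lemma design_curve_not_parametrized (K : closedFieldType) (c2 c4 : K)
    (A : set 'rV[K]_4) :
  (2 : K) != 0 -> (3 : K) != 0 -> c4 != c2 ^+ 2 -> 3 * c2 ^+ 2 != 2 * c4 ->
  A `<=` design_curve c2 c4 -> ~ rationally_parametrized A.
Proof.
move=> two0 three0 c42 c24 AC [num [den [den0 [x [y [Ix Iy xy]]] IA _]]].
pose D := \prod_i den i.
have D0 : D != 0 by apply/prodf_neq0 => i _.
pose P i := num i * \prod_(j | j != i) den j.
have PE i t : (forall j, (den j).[t] != 0) ->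
    (num i).[t] / (den i).[t] = (P i).[t] / D.[t].
  move=> dt; have -> : D = den i * \prod_(j | j != i) den j by rewrite /D (bigD1 i).
  rewrite !hornerM -mulf_div divff ?mulr1 //.
  by rewrite horner_prod; apply/prodf_neq0.
(* A polynomial vanishing wherever the map is defined is zero: its product with [D] vanishes on all
   of [K], which is infinite. *)
have vanish (q : {poly K}) : (forall t, (forall i, (den i).[t] != 0) -> q.[t] = 0) -> q = 0.
  move=> q0; have : q * D = 0.
    apply/eqP; apply: contraT => /closed_nonrootP[t]; rewrite rootE hornerM.
    rewrite mulf_eq0 negb_or horner_prod => /andP[+ /prodf_neq0 dt].
    by rewrite q0 ?eqxx // => i; exact: dt.
  by move/eqP; rewrite mulf_eq0 (negbTE D0) orbF => /eqP.
have onC t : (forall i, (den i).[t] != 0) ->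
    (P 1).[t] ^+ 2 + (P 2).[t] ^+ 2 + (P 3).[t] ^+ 2 = 3 * c2 * (P 0).[t] ^+ 2 /\
    (P 1).[t] ^+ 4 + (P 2).[t] ^+ 4 + (P 3).[t] ^+ 4 = 3 * c4 * (P 0).[t] ^+ 4.
  move=> dt; have Dt : D.[t] != 0 by rewrite horner_prod; apply/prodf_neq0.
  pose z : 'rV[K]_4 := \row_i ((num i).[t] / (den i).[t]).
  have zE i : (P i).[t] = D.[t] * z ord0 i.
    by rewrite mxE PE // mulrC divfK.
  (* A parameter at which all coordinates vanish gives no projective point, but the homogeneous
     equations hold there trivially. *)
  have [z0|z0] := eqVneq z 0.
    by rewrite !zE z0 !mxE !mulr0 !expr0n /= !addr0 !mulr0.
  have /AC/design_curveP[_ e2 e4] : A z by apply: IA; split=> //; exists t.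
  rewrite !zE; split; rewrite !exprMn -!mulrDr; [rewrite e2|rewrite e4]; ring.
have e2 : P 1 ^+ 2 + P 2 ^+ 2 + P 3 ^+ 2 = (3 * c2) *: P 0 ^+ 2.
  apply/eqP; rewrite -subr_eq0; apply/eqP/vanish => t /onC[+ _].
  by rewrite !(hornerD, hornerN, hornerZ, horner_exp) => ->; rewrite subrr.
have e4 : P 1 ^+ 4 + P 2 ^+ 4 + P 3 ^+ 4 = (3 * c4) *: P 0 ^+ 4.
  apply/eqP; rewrite -subr_eq0; apply/eqP/vanish => t /onC[_ +].
  by rewrite !(hornerD, hornerN, hornerZ, horner_exp) => ->; rewrite subrr.
have i4 (Q : 'I_4 -> Prop) : Q 0 -> Q 1 -> Q 2 -> Q 3 -> forall i, Q i.
  move=> Q0 Q1 Q2 Q3 [[|[|[|[|//]]]] hi];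
    [move: Q0|move: Q1|move: Q2|move: Q3]; congr Q; exact: val_inj.
have [j [c cE]] : exists j, exists c : 'I_4 -> K, forall i, P i = c i *: P j.
  suff [j h] : exists j, forall i, exists a, P i = a *: P j.
    by exists j; have [c cE] := choice h; exists c.
  (* If [P 0] is zero, the image is at infinity and [P 2] serves as reference; otherwise [P 0] does.
     The equations are symmetric in the last three coordinates, so each of these can take the role
     of the first. *)
  have [P00|P00] := eqVneq (P 0) 0.
    exists 2; apply: i4.
    - by exists 0; rewrite P00 scale0r.
    - apply: (@fermat_intersection_const _ _ _ (P 3)) => //.
        by rewrite e2 P00 expr0n scaler0.
      by rewrite e4 P00 expr0n scaler0.
    - by exists 1; rewrite scale1r.
    - apply: (@fermat_intersection_const _ _ _ (P 1)) => //.
        by rewrite -addrA addrC [P 2 ^+ _ + _]addrC e2 P00 expr0n scaler0.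
      by rewrite -addrA addrC [P 2 ^+ _ + _]addrC e4 P00 expr0n scaler0.
  have cst := @curve_coord_const _ c2 c4 (P 0) _ _ _ two0 three0 c42 c24 P00.
  exists 0; apply: i4.
  - by exists 1; rewrite scale1r.
  - by apply: (cst _ (P 2) (P 3)).
  - by apply: (cst _ (P 1) (P 3)); rewrite [X in X + _]addrC.
  - by apply: (cst _ (P 1) (P 2)); rewrite -addrA addrC.
case: Ix => x0 [t dt xE]; case: Iy => y0 [s ds yE].
have xcE : x = ((P j).[t] / D.[t]) *: \row_i c i.
  by apply/rowP => i; rewrite xE !mxE PE // cE hornerZ; ring.
have ycE : y = ((P j).[s] / D.[s]) *: \row_i c i.
  by apply/rowP => i; rewrite yE !mxE PE // cE hornerZ; ring.
have k0 : (P j).[t] / D.[t] != 0.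
  by apply: contraNneq x0 => k0; rewrite xcE k0 scale0r.
have /eqP := xy ((P j).[s] / D.[s] / ((P j).[t] / D.[t])); apply.
by rewrite ycE xcE scalerA divfK.
Qed.

(** * Improper integrals of derivatives *)

Section improper_integral.
Context {R : realType}.
Implicit Types (D : set R) (f g F G : R -> R) (r : nat -> R).
Let mu := @lebesgue_measure R.

(** Reduces integrals over an open or unbounded [D] to the fundamental theorem of calculus on
    segments; the nested segments allow monotone convergence. *)
Definition symmetric_exhaustion D r :=
  [/\ forall n, 0 < r n, {homo r : m n / (m <= n)%N >-> m <= n}
    & \bigcup_n `[- r n, r n]%classic = D].

Lemma exhaustion_sub D r n : symmetric_exhaustion D r -> `[- r n, r n]%classic `<=` D.
Proof. by move=> [_ _ <-] x xn; exists n. Qed.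

Lemma exhaustion_homo D r : symmetric_exhaustion D r ->
  {homo (fun n => `[- r n, r n]%classic) : n m / (n <= m)%N >-> (n <= m)%O}.
Proof.
move=> [_ rle _] n m nm; have rnm := rle _ _ nm.
rewrite subsetEset => x /=; rewrite !in_itv /= => /andP[h1 h2].
by rewrite (le_trans _ h1) ?lerN2 // (le_trans h2).
Qed.

Lemma exhaustion_measurable D r : symmetric_exhaustion D r -> measurable D.
Proof. by move=> [_ _ <-]; exact: bigcup_measurable. Qed.

Lemma exhaustion_measurable_fun D r f : symmetric_exhaustion D r ->
  (forall x, D x -> {for x, continuous f}) -> measurable_fun D f.
Proof.
move=> Dr cf; have [_ _ DE] := Dr; rewrite -DE.
apply/measurable_fun_bigcup => // n.
apply: subspace_continuous_measurable_fun => //.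
by apply: continuous_in_subspaceT => x /set_mem/(exhaustion_sub Dr)/cf.
Qed.

Lemma is_derive_continuous f (x df : R) : is_derive x 1 f df -> {for x, continuous f}.
Proof. by move=> [/derivable1_diffP/differentiable_continuous]. Qed.

Lemma integral_derive D F f (a b : R) : a < b -> `[a, b]%classic `<=` D ->
  (forall x, D x -> {for x, continuous f}) ->
  (forall x, D x -> is_derive x 1 F (f x)) ->
  (\int[mu]_(x in `[a, b]) (f x)%:E = (F b - F a)%:E)%E.
Proof.
move=> ab abD cf dF; have cF x : D x -> {for x, continuous F}.
  by move=> /dF; exact: is_derive_continuous.
have Dab x : x \in `[a, b] -> D x by move=> xab; exact: abD.
rewrite (@continuous_FTC2 _ f F) //.
- by apply: continuous_in_subspaceT => x /set_mem/abD/cf.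
- split.
  + by move=> x /subset_itv_oo_cc/Dab/dF[].
  + by apply: cvg_at_right_filter; apply: cF; apply: Dab; rewrite in_itv /= lexx ltW.
  + by apply: cvg_at_left_filter; apply: cF; apply: Dab; rewrite in_itv /= lexx ltW.
- by move=> x /subset_itv_oo_cc/Dab/dF dFx; rewrite derive1E derive_val.
Qed.

(** The integral of [g] over each segment is an increment of [G], hence at most [M]; monotone
    convergence carries this bound to [D]. *)
Lemma dominated_by_derivative_integrable D r f g G (M : R) :
  symmetric_exhaustion D r ->
  (forall x, D x -> {for x, continuous f}) ->
  (forall x, D x -> {for x, continuous g}) ->
  (forall x, D x -> is_derive x 1 G (g x)) ->
  (forall x, D x -> `|f x| <= g x) ->
  (forall n, G (r n) - G (- r n) <= M) ->
  mu.-integrable D (EFin \o f).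
Proof.
move=> Dr cf cg dG fg GM; have [r0 _ DE] := Dr.
have mD := exhaustion_measurable Dr.
have mf := exhaustion_measurable_fun Dr cf.
have mg := exhaustion_measurable_fun Dr cg.
have g0 x : D x -> 0 <= g x by move=> /fg; exact: le_trans.
apply/integrableP; split; first exact/measurable_EFinP.
apply: (@le_lt_trans _ _ (\int[mu]_(x in D) (g x)%:E)%E).
  apply: ge0_le_integral => //.
  - by apply: measurableT_comp => //; exact/measurable_EFinP.
  - exact/measurable_EFinP.
apply: (@le_lt_trans _ _ M%:E); last exact: ltry.
have mono : (\int[mu]_(x in `[(- r n)%R, (r n)%R]%classic) (g x)%:E @[n --> \oo] -->
    \int[mu]_(x in D) (g x)%:E)%E.
  rewrite -DE; apply: ge0_nondecreasing_set_cvg_integral => //.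
  - exact: exhaustion_homo Dr.
  - move=> n; apply/measurable_EFinP; apply: measurable_funS mg => //.
    exact: exhaustion_sub.
  - by move=> n x /(exhaustion_sub Dr)/g0; rewrite lee_fin.
rewrite -(cvg_lim _ mono) //; apply: lime_le; first by apply/cvg_ex; eexists; exact: mono.
apply: nearW => n; rewrite (integral_derive (D := D) (F := G)) ?lee_fin //.
  by rewrite gtrN.
exact: exhaustion_sub.
Qed.

(** Monotone convergence for the positive and the negative part separately; integrability makes both
    limits finite, so they can be subtracted. *)
Lemma integral_exhaustion_cvg D r f : symmetric_exhaustion D r ->
  mu.-integrable D (EFin \o f) ->
  (\int[mu]_(x in `[(- r n)%R, (r n)%R]%classic) (f x)%:E @[n --> \oo] -->
    \int[mu]_(x in D) (f x)%:E)%E.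
Proof.
move=> Dr intf; have mD := exhaustion_measurable Dr; have [_ _ DE] := Dr.
have mf : measurable_fun D (EFin \o f) by case/integrableP: intf.
rewrite [X in _ --> X]integralE; under eq_fun do rewrite integralE.
apply: cvgeB.
- apply: fin_num_adde_defr; apply: integrable_fin_num => //.
  exact: integrable_funepos.
- rewrite -[in X in _ --> X]DE; apply: ge0_nondecreasing_set_cvg_integral => //.
  + exact: exhaustion_homo Dr.
  + move=> n; apply: measurable_funepos; apply: measurable_funS mf => //.
    exact: exhaustion_sub.
- rewrite -[in X in _ --> X]DE; apply: ge0_nondecreasing_set_cvg_integral => //.
  + exact: exhaustion_homo Dr.
  + move=> n; apply: measurable_funeneg; apply: measurable_funS mf => //.
    exact: exhaustion_sub.
Qed.

Lemma Rintegral_derive_cvg D r f F (l : R) : symmetric_exhaustion D r ->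
  mu.-integrable D (EFin \o f) ->
  (forall x, D x -> {for x, continuous f}) ->
  (forall x, D x -> is_derive x 1 F (f x)) ->
  F (r n) - F (- r n) @[n --> \oo] --> l ->
  \int[mu]_(x in D) f x = l.
Proof.
move=> Dr intf cf dF Fl; have [r0 _ _] := Dr.
have mD := exhaustion_measurable Dr.
have h := integral_exhaustion_cvg Dr intf.
have {}h : ((F (r n) - F (- r n))%:E @[n --> \oo] --> \int[mu]_(x in D) (f x)%:E)%E.
  apply: cvg_trans h; apply: near_eq_cvg; apply: nearW => n.
  rewrite (integral_derive (D := D) (F := F)) //; first by rewrite gtrN.
  exact: exhaustion_sub.
have hfin : (\int[mu]_(x in D) (f x)%:E)%E \is a fin_num.
  exact: integrable_fin_num.
move: h; rewrite -(fineK hfin) => /fine_cvg /= h.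
by rewrite /Rintegral; apply: (cvg_unique _ h Fl).
Qed.

Lemma continuous_monomial_mul f (x : R) (k : nat) :
  {for x, continuous f} -> {for x, continuous (fun t : R => t ^+ k * f t)}.
Proof. by move=> cf; apply: cvgM cf; exact: exprn_continuous. Qed.

Lemma is_derive_monomial_mul f (k : nat) (x df : R) : is_derive x 1 f df ->
  is_derive x 1 (fun t : R => t ^+ k * f t) (k%:R * x ^+ k.-1 * f x + x ^+ k * df).
Proof.
move=> dfx; have := is_deriveM (is_deriveX k (is_derive_id x 1)) dfx.
rewrite exprfctE => /is_derive_eq; apply.
by rewrite /= !scaler1 addrC [X in X + _ = _]mulrC.
Qed.

(** Integration by parts with vanishing boundary contribution. For [k = 0] the truncated [k.-1] is
    harmless, as its coefficient is zero. *)
Lemma moment_recurrence D r (w : R -> R) F (k : nat) (c : R) : symmetric_exhaustion D r ->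
  (forall x, D x -> {for x, continuous w}) ->
  mu.-integrable D (EFin \o (fun t : R => t ^+ k.-1 * w t)) ->
  mu.-integrable D (EFin \o (fun t : R => t ^+ k.+1 * w t)) ->
  (forall x, D x -> is_derive x 1 F
    (k%:R * (x ^+ k.-1 * w x) - c * (x ^+ k.+1 * w x))) ->
  F (r n) - F (- r n) @[n --> \oo] --> 0 ->
  k%:R * \int[mu]_(x in D) (x ^+ k.-1 * w x) = c * \int[mu]_(x in D) (x ^+ k.+1 * w x).
Proof.
move=> Dr cw i1 i2 dF F0; apply/eqP; rewrite -subr_eq0; apply/eqP.
have mD := exhaustion_measurable Dr.
have iZ (a : R) (f : R -> R) : mu.-integrable D (EFin \o f) ->
    mu.-integrable D (EFin \o (fun x => a * f x)).
  move=> fi; rewrite (_ : _ \o _ = (fun x => a%:E * (EFin \o f) x)%E) //.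
  exact: integrableZl.
rewrite -!RintegralZl // -RintegralB //; [|exact: iZ|exact: iZ].
apply: (Rintegral_derive_cvg Dr) dF F0.
- rewrite (_ : _ \o _ = (EFin \o (fun x : R => k%:R * (x ^+ k.-1 * w x))%R) \-
    (EFin \o (fun x : R => c * (x ^+ k.+1 * w x))%R))%E //.
  by apply: integrableB => //; exact: iZ.
- move=> x Dx; apply: cvgB; apply: cvgM; try exact: cvg_cst;
    by apply: continuous_monomial_mul; exact: cw.
Qed.

End improper_integral.

(** * Moments of the Gegenbauer and Hermite measures *)

Section gegenbauer_moments.
Context {R : realType}.
Implicit Types (b x : R).
Let mu := @lebesgue_measure R.
Let D : set R := `]-1, 1[%classic.

(** The interval is exhausted up to sines of angles tending to pi / 2, so that [asin] at the
    endpoints is known explicitly when the Chebyshev mass is computed. The angle is (pi / 2)(1 - 1 /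
    (n + 2)); the shift in [harmonic] makes it positive at [n = 0]. *)
Definition sine_angle (n : nat) : R := pi / 2 * (1 - harmonic n.+1).

Definition sine_radius (n : nat) : R := sin (sine_angle n).

Lemma sine_angle_bounds (n : nat) : 0 < sine_angle n < pi / 2.
Proof.
have p0 : 0 < pi / 2 :> R by rewrite divr_gt0 ?pi_gt0.
have h0 : 0 < harmonic n.+1 :> R by rewrite invr_gt0.
have h1 : harmonic n.+1 < 1 :> R by rewrite invf_lt1 ?ltr1n.
by rewrite /sine_angle; apply/andP; split; nra.
Qed.

Lemma sine_angle_homo : {homo sine_angle : m n / (m <= n)%N >-> m <= n}.
Proof.
move=> m n mn; rewrite ler_pM2l ?divr_gt0 ?pi_gt0 // lerD2l lerN2 lef_pV2 ?posrE //.
by rewrite ler_nat !ltnS.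
Qed.

Lemma sine_angle_cvg : sine_angle n @[n --> \oo] --> (pi / 2 : R).
Proof.
rewrite -[X in _ --> X]mulr1; apply: cvgM; first exact: cvg_cst.
rewrite -[X in _ --> X]subr0; apply: cvgB; first exact: cvg_cst.
by rewrite (cvg_shiftS (@harmonic R)); exact: cvg_harmonic.
Qed.

Lemma sine_radius_cvg : sine_radius n @[n --> \oo] --> (1 : R).
Proof.
rewrite -(@sin_pihalf R).
apply: (@continuous_cvg _ _ _ _ _ _ sin); first exact: continuous_sin.
exact: sine_angle_cvg.
Qed.

Lemma sine_radius_bounds n : 0 < sine_radius n < 1.
Proof.
have /andP[a0 a1] := sine_angle_bounds n.
have p0 : 0 < pi / 2 :> R by rewrite divr_gt0 ?pi_gt0.
have h0 : sin 0 < sine_radius n.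
  by rewrite ltr_sin // in_itv /=; apply/andP; split; lra.
have h1 : sine_radius n < sin (pi / 2).
  by rewrite ltr_sin // in_itv /=; apply/andP; split; lra.
by rewrite -[X in X < _](@sin0 R) h0 -[X in _ < X](@sin_pihalf R).
Qed.

Lemma sine_radius_exhaustion : symmetric_exhaustion D sine_radius.
Proof.
have p0 : 0 < pi / 2 :> R by rewrite divr_gt0 ?pi_gt0.
split=> [n|m n mn|].
- by have /andP[] := sine_radius_bounds n.
- have /andP[a0 a1] := sine_angle_bounds m; have /andP[b0 b1] := sine_angle_bounds n.
  rewrite leNgt ltr_sin ?in_itv /=; try by apply/andP; split; lra.
  by rewrite -leNgt sine_angle_homo.
- apply/seteqP; split=> [x [n _]|x].
    rewrite /D /= !in_itv /= => /andP[x1 x2]; have /andP[_ r1] := sine_radius_bounds n.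
    by apply/andP; split; lra.
  rewrite /D /= in_itv /= => /andP[x1 x2].
  have nx : `|x| < 1 by rewrite ltr_norml x1.
  have [n _ /(_ n) hn] := cvgr_gt 1 sine_radius_cvg _ nx.
  by exists n => //=; rewrite in_itv /= -ler_norml ltW // hn /=.
Qed.

Lemma gegenbauer_base_gt0 x : D x -> 0 < 1 - x ^+ 2.
Proof. by rewrite /D /= in_itv /= => /andP[x1 x2]; nra. Qed.

Lemma is_derive_gegenbauer b x : D x ->
  is_derive x 1 (fun t : R => (1 - t ^+ 2) `^ b)
    (- (2 * b * x * (1 - x ^+ 2) `^ (b - 1))).
Proof.
move=> Dx; have x0 := gegenbauer_base_gt0 Dx.
have d1 : is_derive x 1 (fun t : R => 1 - t ^+ 2) (- (2 * x)).
  have := is_deriveB (is_derive_cst (1 : R) x 1) (is_deriveX 2 (is_derive_id x 1)).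
  rewrite exprfctE => /is_derive_eq; apply.
  by rewrite /= sub0r expr1 scaler1.
have := @is_derive1_comp _ (fun y : R => y `^ b) (fun t => 1 - t ^+ 2) x _ _ (is_derive1_powR b x0) d1.
by move=> /is_derive_eq; apply; ring.
Qed.

Lemma powR_split_base b (y : R) : 0 < y -> y `^ b = y * y `^ (b - 1).
Proof.
move=> y0; rewrite -{2}(powRr1 (ltW y0)) -powRD; last by rewrite (gt_eqF y0) implybT.
by rewrite addrC subrK.
Qed.

(** Splitting one factor 1 - x^2 off the power [b] leaves both terms with exponent [b - 1], which is
    that of the Gegenbauer weight when b = lambda + 1/2. *)
Lemma is_derive_monomial_gegenbauer b (k : nat) x : D x ->
  is_derive x 1 (fun t : R => t ^+ k * (1 - t ^+ 2) `^ b)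
    (k%:R * (x ^+ k.-1 * (1 - x ^+ 2) `^ (b - 1)) -
     (k%:R + 2 * b) * (x ^+ k.+1 * (1 - x ^+ 2) `^ (b - 1))).
Proof.
move=> Dx; have x0 := gegenbauer_base_gt0 Dx.
have := is_derive_monomial_mul k (is_derive_gegenbauer b Dx).
move=> /is_derive_eq; apply.
have -> : (1 - x ^+ 2) `^ b = (1 - x ^+ 2) * (1 - x ^+ 2) `^ (b - 1).
  exact: powR_split_base.
by case: k => [|k] /=; rewrite ?exprS; ring.
Qed.

Lemma continuous_gegenbauer b x : D x ->
  {for x, continuous (fun t : R => (1 - t ^+ 2) `^ b)}.
Proof. by move=> /(is_derive_gegenbauer b); exact: is_derive_continuous. Qed.

Lemma gegenbauer_boundary_cvg b (k : nat) : 0 < b ->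
  let F (t : R) := t ^+ k * (1 - t ^+ 2) `^ b in
  F (sine_radius n) - F (- sine_radius n) @[n --> \oo] --> 0.
Proof.
move=> b0 /=; under eq_fun do rewrite sqrrN -mulrBl.
have r1 := sine_radius_cvg.
rewrite -(mulr0 (1 ^+ k - (- 1) ^+ k : R)); apply: cvgM.
  apply: cvgB; first exact: (continuous_cvg _ (@exprn_continuous _ k _) r1).
  by apply: (continuous_cvg _ (@exprn_continuous _ k _)); exact: cvgN.
(* For [b > 0] the power y^b tends to 0 as y decreases to 0; here y = 1 - r^2 along the radii r. *)
have /cvg_at_rightP := powR_cvg0 b0; apply; split.
  by move=> n; apply: gegenbauer_base_gt0; have /andP[h0 h1] := sine_radius_bounds n;
    rewrite /D /= in_itv /=; apply/andP; split; lra.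
rewrite (_ : 0 = 1 - 1 ^+ 2 :> R); last by rewrite expr1n subrr.
by apply: cvgB; [exact: cvg_cst|exact: (continuous_cvg _ (@exprn_continuous _ 2 _) r1)].
Qed.

(* The antiderivative of the dominating function is
   ((1 + 2b) t - t (1 - t^2)^b) / (2b). *)
Lemma gegenbauer_integrable b (k : nat) : 0 < b ->
  mu.-integrable D (EFin \o (fun t : R => t ^+ k * (1 - t ^+ 2) `^ (b - 1))).
Proof.
move=> b0; have Dr := sine_radius_exhaustion.
pose G (t : R) := (2 * b)^-1 * ((1 + 2 * b) * t - t ^+ 1 * (1 - t ^+ 2) `^ b).
pose g (t : R) := (2 * b)^-1 * ((1 + 2 * b) - (1%:R * (t ^+ 0 * (1 - t ^+ 2) `^ (b - 1)) -
   (1%:R + 2 * b) * (t ^+ 2 * (1 - t ^+ 2) `^ (b - 1)))).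
apply: (@dominated_by_derivative_integrable _ D sine_radius _ g G ((1 + 2 * b) / b) Dr).
- by move=> x Dx; apply: continuous_monomial_mul; exact: continuous_gegenbauer.
- move=> x Dx; apply: cvgM; first exact: cvg_cst.
  apply: cvgB; first exact: cvg_cst.
  apply: cvgB; apply: cvgM; try exact: cvg_cst;
    by apply: continuous_monomial_mul; exact: continuous_gegenbauer.
- move=> x Dx.
  have d1 := is_deriveZ (1 + 2 * b) (is_derive_id x 1).
  have d2 := is_deriveZ (2 * b)^-1 (is_deriveB d1 (is_derive_monomial_gegenbauer b 1 Dx)).
  by apply: (is_derive_eq (f := G) d2); rewrite /g /GRing.scale /=; ring.
- move=> x Dx; have x0 := gegenbauer_base_gt0 Dx.
  have W0 : 0 < (1 - x ^+ 2) `^ (b - 1) by rewrite powR_gt0.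
  (* With W the weight at [x], [g x] exceeds W by (1 + 2b)(1 - (1 - x^2) W) / (2b), which this bound
     makes nonnegative. *)
  have : (1 - x ^+ 2) * (1 - x ^+ 2) `^ (b - 1) <= 1.
    rewrite -powR_split_base //.
    apply: (@le_trans _ _ (1 `^ b)); last by rewrite powR1.
    have x2 : 1 - x ^+ 2 <= 1 by have := sqr_ge0 x; lra.
    by apply: ge0_ler_powR; rewrite ?nnegrE // ltW.
  have xk : `|x ^+ k| <= 1.
    rewrite normrX exprn_ile1 // ltW // ltr_norml.
    by move: Dx; rewrite /D /= in_itv.
  rewrite normrM (gtr0_norm W0) => V1.
  apply: (@le_trans _ _ ((1 - x ^+ 2) `^ (b - 1))); first by nra.
  rewrite /g mulrC ler_pdivlMr; last by lra.
  by nra.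
- move=> n; have /andP[r0 r1] := sine_radius_bounds n; rewrite /G sqrrN.
  rewrite -mulrBr mulrC ler_pdivrMr; last by lra.
  have V0 : 0 <= (1 - sine_radius n ^+ 2) `^ b by exact: powR_ge0.
  rewrite (_ : (1 + 2 * b) / b * (2 * b) = 2 * (1 + 2 * b)); first by nra.
  by field; rewrite gt_eqF.
Qed.

Lemma gegenbauer_recurrence b (k : nat) : 0 < b ->
  k%:R * \int[mu]_(t in D) (t ^+ k.-1 * (1 - t ^+ 2) `^ (b - 1)) =
  (k%:R + 2 * b) * \int[mu]_(t in D) (t ^+ k.+1 * (1 - t ^+ 2) `^ (b - 1)).
Proof.
move=> b0; apply: (moment_recurrence sine_radius_exhaustion).
- by move=> x; exact: continuous_gegenbauer.
- exact: gegenbauer_integrable.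
- exact: gegenbauer_integrable.
- by move=> x; exact: is_derive_monomial_gegenbauer.
- exact: gegenbauer_boundary_cvg.
Qed.

(** On a segment [-r, r] the weight dominates the derivative of t (1 - t^2)^b, whose integral there
    is 2 r (1 - r^2)^b > 0. *)
Lemma gegenbauer_mass_gt0 b : 0 < b ->
  0 < \int[mu]_(t in D) (1 - t ^+ 2) `^ (b - 1).
Proof.
move=> b0; have Dr := sine_radius_exhaustion; have mD := exhaustion_measurable Dr.
have := gegenbauer_integrable 0 b0; set w := (fun t : R => _ * _) => iw.
have wE : \int[mu]_(t in D) w t = \int[mu]_(t in D) (1 - t ^+ 2) `^ (b - 1).
  by apply: eq_Rintegral => t _; rewrite /w mul1r.
rewrite -wE; set r := sine_radius 0; have /andP[r0 r1] := sine_radius_bounds 0.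
have rD : `[- r, r]%classic `<=` D by exact: exhaustion_sub Dr.
pose f (t : R) := 1%:R * (t ^+ 0 * (1 - t ^+ 2) `^ (b - 1)) -
   (1%:R + 2 * b) * (t ^+ 2 * (1 - t ^+ 2) `^ (b - 1)).
have cf x : D x -> {for x, continuous f}.
  by move=> Dx; apply: cvgB; apply: cvgM; try exact: cvg_cst;
    apply: continuous_monomial_mul; exact: continuous_gegenbauer.
have rr : - r < r by rewrite gtrN.
have fE := integral_derive rr rD cf (is_derive_monomial_gegenbauer b 1).
have fpos : 0 < r ^+ 1 * (1 - r ^+ 2) `^ b - (- r) ^+ 1 * (1 - (- r) ^+ 2) `^ b.
  rewrite sqrrN !expr1 -mulrBl opprK mulr_gt0 ?addr_gt0 //.
  by apply: powR_gt0; apply: gegenbauer_base_gt0; apply: rD; rewrite /= in_itv /= lexx ltW.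
have w0 x : D x -> 0 <= w x by move=> _; rewrite /w mul1r powR_ge0.
rewrite -lte_fin /Rintegral fineK; last exact: integrable_fin_num.
apply: (lt_le_trans (y := (\int[mu]_(x in `[(- r)%R, r]) (f x)%:E)%E)).
  by rewrite fE lte_fin.
have mw : measurable_fun D (EFin \o w) by case/integrableP: iw.
apply: (@le_trans _ _ (\int[mu]_(x in `[(- r)%R, r]) (w x)%:E)%E); last first.
  apply: ge0_subset_integral => //.
have iwr : mu.-integrable `[- r, r]%classic (EFin \o w).
  by apply: integrableS iw.
have ifr : mu.-integrable `[- r, r]%classic (EFin \o f).
  apply: continuous_compact_integrable; first exact: segment_compact.
  by apply: continuous_in_subspaceT => x /set_mem/rD/cf.
apply: le_integral => // x /set_mem/rD Dx; rewrite lee_fin /f /w.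
have W0 : 0 <= (1 - x ^+ 2) `^ (b - 1) by exact: powR_ge0.
have : 0 <= (1 + 2 * b) * (x ^+ 2 * (1 - x ^+ 2) `^ (b - 1)).
  by apply: mulr_ge0; [lra|rewrite mulr_ge0 ?sqr_ge0].
by rewrite !expr0; lra.
Qed.

Lemma chebyshev_mass : \int[mu]_(t in D) (1 - t ^+ 2) `^ (- 2^-1) = pi.
Proof.
have b0 : 0 < 2^-1 :> R by rewrite invr_gt0.
have e : - 2^-1 = 2^-1 - 1 :> R by lra.
have Dr := sine_radius_exhaustion.
have cw (x : R) : D x -> {for x, continuous (fun t : R => (1 - t ^+ 2) `^ (- 2^-1))}.
  by exact: continuous_gegenbauer.
apply: (Rintegral_derive_cvg Dr (F := @asin R)) => //.
- have := gegenbauer_integrable 0 b0; rewrite -e.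
  by congr (mu.-integrable D (EFin \o _)); apply/funext => t; rewrite mul1r.
- move=> x Dx; have x0 := gegenbauer_base_gt0 Dx.
  have h : -1 < x < 1 by move: Dx; rewrite /D /= in_itv.
  have := is_derive1_asin h; move=> /is_derive_eq; apply.
  by rewrite powRN powR12_sqrt // ltW.
- have p0 : 0 < pi / 2 :> R by rewrite divr_gt0 ?pi_gt0.
  have asinE n : asin (sine_radius n) - asin (- sine_radius n) = sine_angle n * 2.
    have /andP[a0 a1] := sine_angle_bounds n.
    rewrite /sine_radius -sinN !sinK; last 2 first.
    - by rewrite in_itv /=; apply/andP; split; lra.
    - by rewrite in_itv /=; apply/andP; split; lra.
    by rewrite opprK mulr_natr mulr2n.
  under eq_fun do rewrite asinE.
  have -> : pi = pi / 2 * 2 :> R by rewrite divfK // pnatr_eq0.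
  by apply: cvgM; [exact: sine_angle_cvg|exact: cvg_cst].
Qed.

End gegenbauer_moments.

(** * Integrability and moments of the Gaussian weight *)

Section hermite_moments.
Context {R : realType}.
Let mu := @lebesgue_measure R.
Let radius (n : nat) : R := n.+1%:R.

Lemma natural_exhaustion : symmetric_exhaustion [set: R] radius.
Proof.
split=> [n|m n mn|]; first exact: ltr0n.
  by rewrite ler_nat ltnS.
apply/seteqP; split=> // x _; have [n hn] : exists n : nat, `|x| < n%:R.
  by exists (Num.bound `|x|); exact: archi_boundP.
exists n => //=; rewrite in_itv /= -ler_norml (le_trans (ltW hn)) //.
by rewrite /radius ler_nat.
Qed.

(* exp(t^2) >= (1 + t^2 / 4)^4 >= (1 + t^2)^4 / 256. *)
Lemma monomial_gauss_le (k : nat) (x : R) : (k <= 6)%N ->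
  `|x ^+ k * gauss_fun x| <= 256 / (1 + x ^+ 2).
Proof.
move=> k6; set y := x ^+ 2; have y0 : 0 <= y by exact: sqr_ge0.
have e4 : (1 + y) ^+ 4 / 256 <= expR y.
  have -> : expR y = expR (y / 4) ^+ 4.
    by rewrite -expRM_natl -mulr_natl; congr expR; field.
  have h : (1 + y) / 4 <= expR (y / 4).
    by apply: le_trans (expR_ge1Dx _); lra.
  have -> : (1 + y) ^+ 4 / 256 = ((1 + y) / 4) ^+ 4 by field.
  by apply: lerXn2r => //; rewrite nnegrE; lra.
have xk : `|x| ^+ k <= (1 + y) ^+ 3.
  have ax : `|x| ^+ 2 = y by rewrite -normrX ger0_norm.
  have ax0 : 0 <= `|x| by [].
  have [x1|x1] := leP `|x| 1.
    apply: (@le_trans _ _ 1); first by rewrite exprn_ile1.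
    by rewrite exprn_ege1 // lerDl.
  apply: (@le_trans _ _ (`|x| ^+ 6)); first by rewrite ler_weXn2l // ltW.
  by rewrite (exprM `|x| 2 3) ax; apply: lerXn2r; rewrite ?nnegrE //; lra.
rewrite normrM normrX (ger0_norm (gauss_fun_ge0 _)) /gauss_fun expRN.
rewrite ler_pdivlMr; last by lra.
rewrite mulrAC ler_pdivrMr ?expR_gt0 //.
have : (1 + y) ^+ 4 <= 256 * expR y by lra.
apply: le_trans; rewrite [leRHS]exprSr ler_wpM2r //; lra.
Qed.

Lemma is_derive_gauss (x : R) : is_derive x 1 (@gauss_fun R) (- (2 * x * gauss_fun x)).
Proof.
have d1 : is_derive x 1 (fun t : R => - t ^+ 2) (- (2 * x)).
  have := is_deriveN (is_deriveX 2 (is_derive_id x 1)).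
  rewrite exprfctE => /is_derive_eq; apply.
  by rewrite /= expr1 scaler1.
have := @is_derive1_comp _ expR (fun t : R => - t ^+ 2) x _ _ (is_derive_expR _) d1.
by move=> /is_derive_eq; apply; rewrite /gauss_fun; ring.
Qed.

Lemma is_derive_monomial_gauss (k : nat) (x : R) :
  is_derive x 1 (fun t : R => t ^+ k * gauss_fun t)
    (k%:R * (x ^+ k.-1 * gauss_fun x) - 2 * (x ^+ k.+1 * gauss_fun x)).
Proof.
have := is_derive_monomial_mul k (is_derive_gauss x).
by move=> /is_derive_eq; apply; rewrite exprS; ring.
Qed.

(** The dominating function 256 / (1 + t^2) has the bounded antiderivative 256 atan t. The range up
    to 6 covers both sides of the recurrence for [k <= 5]. *)
Lemma hermite_integrable (k : nat) : (k <= 6)%N ->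
  mu.-integrable [set: R] (EFin \o (fun t : R => t ^+ k * gauss_fun t)).
Proof.
move=> k6; pose g (t : R) := 256 * (1 + t ^+ 2)^-1.
have p0 (t : R) : 0 < 1 + t ^+ 2 by have := sqr_ge0 t; lra.
apply: (@dominated_by_derivative_integrable _ _ radius _ g (fun t => 256 * atan t) (256 * pi)).
- exact: natural_exhaustion.
- by move=> x _; apply: continuous_monomial_mul; exact: continuous_gauss_fun.
- move=> x _; apply: cvgM; first exact: cvg_cst.
  apply: cvgV; first by rewrite gt_eqF.
  by apply: cvgD; [exact: cvg_cst|exact: exprn_continuous].
- by move=> x _; exact: monomial_gauss_le.
- move=> n; have := atan_ltpi2 (radius n); have := atan_gtNpi2 (- radius n); lra.
Qed.

Lemma hermite_recurrence (k : nat) : (k <= 5)%N ->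
  k%:R * \int[mu]_(t in [set: R]) (t ^+ k.-1 * gauss_fun t) =
  2 * \int[mu]_(t in [set: R]) (t ^+ k.+1 * gauss_fun t).
Proof.
move=> k5; have k6 : (k <= 6)%N by exact: leqW.
apply: (moment_recurrence natural_exhaustion).
- by move=> x _; exact: continuous_gauss_fun.
- by apply: hermite_integrable; exact: leq_trans (leq_pred _) k6.
- exact: hermite_integrable.
- by move=> x _; exact: is_derive_monomial_gauss.
(* The bound that gives integrability also sends the boundary terms to 0. *)
have lim0 : 256 / (1 + radius n ^+ 2) @[n --> \oo] --> (0 : R).
  rewrite -(mulr0 (256 : R)); apply: cvgM; first exact: cvg_cst.
  apply: (@squeeze_cvgr _ _ _ _ (cst 0) (@harmonic R)).
  - apply: nearW => n; rewrite /harmonic /=.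
    have n1 : 1 <= radius n by rewrite ler1n.
    have n2 : radius n <= 1 + radius n ^+ 2 by nra.
    by rewrite invr_ge0 lef_pV2 ?posrE; [rewrite n2 andbT|..]; lra.
  - exact: cvg_cst.
  - exact: cvg_harmonic.
have sq (u : nat -> R) : (forall n, `|u n| <= 256 / (1 + radius n ^+ 2)) ->
    u n @[n --> \oo] --> 0.
  move=> ud; apply: (@squeeze_cvgr _ _ _ _ (fun n => - (256 / (1 + radius n ^+ 2)))
    (fun n => 256 / (1 + radius n ^+ 2))) (lim0).
    by apply: nearW => n; rewrite -ler_norml.
  by rewrite -[X in _ --> X]oppr0; apply: cvgN.
rewrite -[X in _ --> X](subr0 (0 : R)); apply: cvgB; apply: sq => n.
  exact: monomial_gauss_le.
by rewrite -[X in 1 + X]sqrrN; exact: monomial_gauss_le.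
Qed.

Lemma hermite_mass : \int[mu]_(t in [set: R]) (t ^+ 0 * gauss_fun t) = Num.sqrt pi.
Proof.
transitivity (\int[mu]_(t in [set: R]) gauss_fun t).
  by apply: eq_Rintegral => t _; rewrite mul1r.
by rewrite /Rintegral integralT_gauss.
Qed.

End hermite_moments.

(** * Normalized moments and the equations of antipodal designs *)

Section classical_moments.
Context {R : realType}.
Implicit Types (I : set R) (w : R -> R).
Let mu := @lebesgue_measure R.

(** What both families share: under these conditions the integral of a polynomial of degree at most
    5 depends on the weight only through its second and fourth moments. *)
Definition normalized_symmetric_weight I w :=
  [/\ measurable I,
      forall k : nat, (k <= 5)%N -> mu.-integrable I (EFin \o (fun t => t ^+ k * w t)),
      wmoment I w 0 = 1
    & forall k : nat, (k <= 5)%N -> odd k -> wmoment I w k = 0].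

Lemma scaled_weight_moment I w (W : R -> R) (Z : R) (k : nat) : measurable I ->
  mu.-integrable I (EFin \o (fun t => t ^+ k * W t)) ->
  (forall t, I t -> w t = W t / Z) ->
  mu.-integrable I (EFin \o (fun t => t ^+ k * w t)) /\
  wmoment I w k = \int[mu]_(t in I) (t ^+ k * W t) / Z.
Proof.
move=> mI iW wE; have e t : I t -> t ^+ k * w t = Z^-1 * (t ^+ k * W t).
  by move=> It; rewrite wE //; ring.
split.
  apply: (@eq_integrable _ _ _ mu I mI (fun t => (Z^-1)%:E * (EFin \o (fun t => t ^+ k * W t)%R) t)%E).
    by move=> t /set_mem It; rewrite /= e.
  exact: integrableZl.
rewrite mulrC -RintegralZl //.
by apply: eq_Rintegral => t /set_mem It; rewrite e.
Qed.

Lemma hermite_wmoments I w : I = setT -> (forall t, I t -> w t = hermite_weight t) ->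
  [/\ normalized_symmetric_weight I w, wmoment I w 2 = 1 / 2 & wmoment I w 4 = 3 / 4].
Proof.
move=> IT wE; have mI : measurable I by rewrite IT.
have s0 : Num.sqrt pi != 0 :> R by rewrite gt_eqF // sqrtr_gt0 pi_gt0.
have sc k : (k <= 6)%N -> _ := fun k6 => @scaled_weight_moment I w _ (Num.sqrt pi) k mI
  (eq_rect_r (fun J => mu.-integrable J _) (hermite_integrable k6) IT) wE.
have mE k : (k <= 6)%N -> wmoment I w k =
    \int[mu]_(t in [set: R]) (t ^+ k * gauss_fun t) / Num.sqrt pi.
  by move=> /sc[_ ->]; rewrite IT.
have rec k : (k <= 5)%N -> k%:R * wmoment I w k.-1 = 2 * wmoment I w k.+1.
  move=> k5; rewrite !mE //; last by exact: leq_trans (leq_pred _) (leqW k5).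
  by rewrite !mulrA hermite_recurrence.
have m0 : wmoment I w 0 = 1 by rewrite mE // hermite_mass divff.
have r0 := rec 0 isT; have r1 := rec 1 isT; have r2 := rec 2 isT.
have r3 := rec 3 isT; have r4 := rec 4 isT; rewrite /= in r0 r1 r2 r3 r4.
split; [split=> //| lra | lra].
  by move=> k k5; have [|] := sc k => //; exact: leqW.
by move=> [|[|[|[|[|[|k]]]]]] // _ _; lra.
Qed.

Lemma gegenbauer_wmoments (lambda : R) I w : - 2^-1 < lambda -> I = `]-1, 1[%classic ->
  (forall t, I t -> w t = gegenbauer_weight lambda t) ->
  [/\ normalized_symmetric_weight I w, wmoment I w 2 = (2 * lambda + 2)^-1
    & wmoment I w 4 = 3 / ((2 * lambda + 2) * (2 * lambda + 4))].
Proof.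
move=> l0 IE wE; pose b := lambda + 2^-1.
have b0 : 0 < b by rewrite /b; lra.
have bE : lambda - 2^-1 = b - 1 by rewrite /b; lra.
have mI : measurable I by rewrite IE.
set Z := \int[mu]_(s in `]-1, 1[%classic) ((1 - s ^+ 2) `^ (lambda - 2^-1)).
have Z0 : 0 < Z by rewrite /Z bE; exact: gegenbauer_mass_gt0.
have sc k := @scaled_weight_moment I w _ Z k mI
  (eq_rect_r (fun J => mu.-integrable J _) (gegenbauer_integrable k b0) IE).
have {}sc k : mu.-integrable I (EFin \o (fun t => t ^+ k * w t)) /\ wmoment I w k =
    \int[mu]_(t in `]-1, 1[%classic) (t ^+ k * (1 - t ^+ 2) `^ (b - 1)) / Z.
  have [|i e] := sc k; last by split; [exact: i|rewrite e IE].
  by move=> t It; rewrite wE // /gegenbauer_weight -/Z bE.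
have rec k : k%:R * wmoment I w k.-1 = (k%:R + 2 * b) * wmoment I w k.+1.
  by rewrite !(sc _).2 !mulrA gegenbauer_recurrence.
have m0 : wmoment I w 0 = 1.
  rewrite (sc 0).2 /Z bE.
  rewrite (_ : \int[mu]_(t in _) _ = \int[mu]_(s in `]-1, 1[%classic) ((1 - s ^+ 2) `^ (b - 1))).
    by rewrite divff // gt_eqF // gegenbauer_mass_gt0.
  by apply: eq_Rintegral => t _; rewrite mul1r.
(* As 2b = 2 lambda + 1, the even [k] kill the odd moments one after another from [k = 0], while
   [k = 1] and [k = 3] give the second and fourth moments. *)
have r0 := rec 0; have r1 := rec 1; have r2 := rec 2.
have r3 := rec 3; have r4 := rec 4; rewrite /= in r0 r1 r2 r3 r4.
have cancel0 (c m : R) : 0 < c -> 0 = c * m -> m = 0.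
  by move=> c0 /esym/eqP; rewrite mulf_eq0 gt_eqF //= => /eqP.
have m1 : wmoment I w 1 = 0 by apply: (cancel0 (0%:R + 2 * b)); [lra|rewrite -r0 mul0r].
have m3 : wmoment I w 3 = 0 by apply: (cancel0 (2%:R + 2 * b)); [lra|rewrite -r2 m1 mulr0].
have m5 : wmoment I w 5 = 0 by apply: (cancel0 (4%:R + 2 * b)); [lra|rewrite -r4 m3 mulr0].
have m2 : wmoment I w 2 = (2 * lambda + 2)^-1.
  have c0 : 2 * lambda + 2 != 0 by rewrite gt_eqF //; rewrite /b in b0; lra.
  apply: (mulfI c0); rewrite divff //.
  by move: r1; rewrite m0 /b; lra.
split=> //; first by split=> // [k _|]; [case: (sc k)|case=> [|[|[|[|[|[|k]]]]]]].
have c2 : 2 * lambda + 2 != 0 by rewrite gt_eqF //; rewrite /b in b0; lra.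
have c4 : 2 * lambda + 4 != 0 by rewrite gt_eqF //; rewrite /b in b0; lra.
apply: (mulfI c4).
transitivity (3 * wmoment I w 2); last by rewrite m2; field; rewrite c2 c4.
by move: r3; rewrite /b; lra.
Qed.

Lemma Rintegral_sum_weight I w (a : nat -> R) (n : nat) : measurable I ->
  (forall k : nat, (k < n)%N -> mu.-integrable I (EFin \o (fun t => t ^+ k * w t))) ->
  mu.-integrable I (EFin \o (fun t => (\sum_(i < n) a i * t ^+ i) * w t)) /\
  \int[mu]_(t in I) ((\sum_(i < n) a i * t ^+ i) * w t) = \sum_(i < n) a i * wmoment I w i.
Proof.
move=> mI; elim: n => [|n IHn] iw.
  have e : (fun t : R => (\sum_(i < 0) a i * t ^+ i) * w t) = cst 0.
    by apply/funext => t; rewrite big_ord0 mul0r.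
  rewrite e; split; first exact: integrable0.
  by rewrite big_ord0 Rintegral_cst // mul0r.
have [|ihi ihE] := IHn; first by move=> k kn; apply: iw; exact: ltnW.
have iZ : mu.-integrable I (EFin \o (fun t => a n * (t ^+ n * w t))).
  rewrite (_ : _ \o _ = (fun t => (a n)%:E * (EFin \o (fun t => t ^+ n * w t)%R) t)%E) //.
  by apply: integrableZl => //; exact: iw.
have e : (fun t : R => (\sum_(i < n.+1) a i * t ^+ i) * w t) =
    (fun t => (\sum_(i < n) a i * t ^+ i) * w t + a n * (t ^+ n * w t)).
  by apply/funext => t; rewrite big_ord_recr /=; ring.
rewrite e; split.
  rewrite (_ : _ \o _ = (EFin \o (fun t => (\sum_(i < n) a i * t ^+ i) * w t)%R) \+
    (EFin \o (fun t => a n * (t ^+ n * w t))%R))%E //.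
  exact: integrableD.
rewrite RintegralD // ihE big_ord_recr /= RintegralZl //; exact: iw.
Qed.

Lemma Rintegral_poly_weight I w (f : {poly R}) : normalized_symmetric_weight I w ->
  (size f <= 6)%N ->
  \int[mu]_(t in I) (f.[t] * w t) = f`_0 + f`_2 * wmoment I w 2 + f`_4 * wmoment I w 4.
Proof.
move=> [mI iw m0 modd] sf.
have [] := @Rintegral_sum_weight I w (fun i => f`_i) 6 mI; first by move=> k; exact: iw.
move=> _; rewrite !big_ord_recl big_ord0 /= /bump /= m0 (modd 1%N) // (modd 3%N) // (modd 5%N) // => e.
transitivity (\int[mu]_(t in I) ((\sum_(i < 6) f`_i * t ^+ i) * w t)).
  by apply: eq_Rintegral => t _; rewrite -(horner_coef_wide _ sf).
by rewrite e; ring.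
Qed.

(** Odd monomials contribute nothing to the sum or to the integral, and constants agree by
    normalization. Only X^2 and X^4 impose conditions. *)
Lemma antipodal_designP I w (x : 6.-tuple R) (x1 x2 x3 : R) :
  normalized_symmetric_weight I w -> x = [:: x1; - x1; x2; - x2; x3; - x3] :> seq R ->
  design I w 5 x <->
  [/\ uniq x, forall t, t \in x -> I t,
      x1 ^+ 2 + x2 ^+ 2 + x3 ^+ 2 = 3 * wmoment I w 2
    & x1 ^+ 4 + x2 ^+ 4 + x3 ^+ 4 = 3 * wmoment I w 4].
Proof.
move=> wI xE.
have sumE (f : {poly R}) : (size f <= 6)%N -> 6%:R^-1 * \sum_(t <- x) f.[t] =
    f`_0 + f`_2 * ((x1 ^+ 2 + x2 ^+ 2 + x3 ^+ 2) / 3)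
         + f`_4 * ((x1 ^+ 4 + x2 ^+ 4 + x3 ^+ 4) / 3).
  move=> sf; rewrite xE !big_cons big_nil !(horner_coef_wide _ sf).
  by rewrite !big_ord_recl !big_ord0 /= /bump /=; field.
split=> [[ux xI h]|[ux xI e2 e4]].
  split=> //.
    have := h 'X^2; rewrite size_polyXn sumE ?size_polyXn // Rintegral_poly_weight ?size_polyXn //.
    by rewrite !coefXn /= => /(_ isT); lra.
  have := h 'X^4; rewrite size_polyXn sumE ?size_polyXn // Rintegral_poly_weight ?size_polyXn //.
  by rewrite !coefXn /= => /(_ isT); lra.
split=> // f sf; rewrite sumE // Rintegral_poly_weight // e2 e4.
by field.
Qed.

End classical_moments.

Theorem theorem1p2 (R : realType) :
  (forall (I : set R) (w : R -> R), symmetric_classical_measure I w ->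
     (* K: any algebraically closed subfield of the complex numbers containing
        the two moments, e.g. the algebraic numbers when these are algebraic *)
     forall (K : closedFieldType) (iota : {rmorphism K -> R[i]}) (c2 c4 : K),
       iota c2 = real_complex R (wmoment I w 2) ->
       iota c4 = real_complex R (wmoment I w 4) ->
       (forall x1 x2 x3 : rat,
          let x := map_tuple (@ratr R) (antipodal6 x1 x2 x3) in
          design I w 5 x <->
          [/\ uniq x, forall t, t \in x -> I t
            & design_curve c2 c4 (affine_point (ratr x1) (ratr x2) (ratr x3))])
       /\
       ((forall A : set 'rV[K]_4, irreducible_component (design_curve c2 c4) A ->
           rationally_parametrized A) ->
        3 * wmoment I w 2 ^+ 2 = 2 * wmoment I w 4))
  /\
  (forall (I : set R) (w : R -> R),
     symmetric_classical_measure I w /\ 3 * wmoment I w 2 ^+ 2 = 2 * wmoment I w 4 <->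
     chebyshev_measure I w).
Proof.
split=> [I w Iw K iota c2 c4 ic2 ic4|I w].
  (* The inequality says that t^2 has nonzero variance. It is read off the explicit moments; in the
     Gegenbauer case the numerator 4 lambda + 2 is positive. *)
  have [wI nsq] : normalized_symmetric_weight I w /\ wmoment I w 4 != wmoment I w 2 ^+ 2.
    case: Iw => [[IT wE]|[lambda [l0 IE wE]]].
      have [? -> ->] := hermite_wmoments IT wE; split=> //.
      by apply/eqP; lra.
    have [? -> ->] := gegenbauer_wmoments l0 IE wE; split=> //.
    have c2' : 2 * lambda + 2 != 0 by rewrite gt_eqF //; lra.
    have c4' : 2 * lambda + 4 != 0 by rewrite gt_eqF //; lra.
    rewrite -subr_eq0 (_ : _ - _ = (4 * lambda + 2) / ((2 * lambda + 2) ^+ 2 * (2 * lambda + 4))).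
      by rewrite mulf_neq0 ?invr_neq0 ?mulf_neq0 ?expf_neq0 // gt_eqF //; lra.
    by field; rewrite c2' c4'.
  (* Injectivity of [iota] transfers equations between [K] and the reals. *)
  have iotaE (p q : K) (p' q' : R) : iota p = real_complex R p' -> iota q = real_complex R q' ->
      p = q <-> p' = q'.
    move=> pE qE; split=> [pq|pq].
      by have := congr1 iota pq; rewrite pE qE => -[].
    by apply: (fmorph_inj iota); rewrite pE qE pq.
  split=> [x1 x2 x3 x|param].
    have xE : x = [:: ratr x1; - ratr x1; ratr x2; - ratr x2; ratr x3; - ratr x3] :> seq R.
      by rewrite /= !rmorphN.
    have ap0 : affine_point (ratr x1) (ratr x2) (ratr x3) != 0 :> 'rV[K]_4.
      apply/eqP => /matrixP /(_ ord0 0); rewrite !mxE /= => /eqP.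
      by rewrite oner_eq0.
    have sumE k : iota (ratr x1 ^+ k + ratr x2 ^+ k + ratr x3 ^+ k) =
        real_complex R (ratr x1 ^+ k + ratr x2 ^+ k + ratr x3 ^+ k).
      by rewrite !rmorphD !rmorphXn /= !fmorph_rat.
    have mulE c a : iota c = real_complex R a -> iota (3 * c) = real_complex R (3 * a).
      by move=> ca; rewrite !rmorphM /= ca !rmorph_nat.
    have e2 := iotaE _ _ _ _ (sumE 2%N) (mulE _ _ ic2).
    have e4 := iotaE _ _ _ _ (sumE 4%N) (mulE _ _ ic4).
    apply: (iff_trans (antipodal_designP wI xE)).
    split=> [[ux xI /e2 h2 /e4 h4]|[ux xI /design_curveP[_]]].
      by split=> //; apply/design_curveP; rewrite !mxE /= !expr1n !mulr1.
    by rewrite !mxE /= !expr1n !mulr1 => /e2 h2 /e4 h4.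
  apply: contrapT => /eqP ne.
  have char0 n : (n.+1%:R : K) != 0.
    by rewrite -(fmorph_eq0 iota) rmorph_nat pnatr_eq0.
  have c42 : c4 != c2 ^+ 2.
    apply: contra_neq nsq => e; apply/(iotaE c4 (c2 ^+ 2)) => //.
    by rewrite !rmorphXn /= ic2.
  have c24 : 3 * c2 ^+ 2 != 2 * c4.
    apply: contra_neq ne => e; apply/(iotaE (3 * c2 ^+ 2) (2 * c4)) => //.
      by rewrite !rmorphM /= ic2 !rmorph_nat.
    by rewrite !rmorphM /= ic4 !rmorph_nat.
  (* The existence of a component keeps the hypothesis [param] from being vacuous. *)
  have [A AC] := exists_irreducible_component (design_curve_closed c2 c4)
    (design_curve_nonempty c2 c4).
  have [_ AZ _] := AC.
  exact: (design_curve_not_parametrized (char0 1%N) (char0 2%N) c42 c24 AZ (param A AC)).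
have half : 0 - 2^-1 = - 2^-1 :> R by rewrite sub0r.
split=> [[[[IT wE]|[lambda [l0 IE wE]]] e]|[IE wE]].
- by have [_ m2 m4] := hermite_wmoments IT wE; move: e; rewrite m2 m4; lra.
- have [_ m2 m4] := gegenbauer_wmoments l0 IE wE; move: e; rewrite m2 m4 => e.
  have c2' : 2 * lambda + 2 != 0 by rewrite gt_eqF //; lra.
  have c4' : 2 * lambda + 4 != 0 by rewrite gt_eqF //; lra.
  have l : lambda = 0.
    have : 3 * (2 * lambda + 2)^-1 ^+ 2 - 2 * (3 / ((2 * lambda + 2) * (2 * lambda + 4))) = 0.
      by rewrite e subrr.
    (* The difference 3 a2^2 - 2 a4 in closed form; its numerator vanishes only at lambda = 0. *)
    rewrite (_ : _ - _ = - (6 * lambda) / ((2 * lambda + 2) ^+ 2 * (2 * lambda + 4))); last first.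
      by field; rewrite c2' c4'.
    have den0 : (2 * lambda + 2) ^+ 2 * (2 * lambda + 4) != 0 by rewrite mulf_neq0 ?expf_neq0.
    move/eqP; rewrite mulf_eq0 invr_eq0 (negbTE den0) orbF oppr_eq0 mulf_eq0 pnatr_eq0.
    by move=> /eqP.
  by split=> // t It; rewrite wE // /gegenbauer_weight l half chebyshev_mass.
have l0 : - 2^-1 < 0 :> R by rewrite oppr_lt0 invr_gt0.
have wE' t : I t -> w t = gegenbauer_weight 0 t.
  by move=> It; rewrite wE // /gegenbauer_weight half chebyshev_mass.
split; first by right; exists 0.
by have [_ -> ->] := gegenbauer_wmoments l0 IE wE'; field.
Qed.
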